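(* Let $\mathcal{C}=\{1,\dots,C\}$ and $\mathcal{T}=\{1,\dots,T\}$, and let $E_c$ ($c\in\mathcal{C}$) be nonzero real numbers. For every $y\in\mathbb{R}^{\mathcal{C}\times\mathcal{T}}$ with $0\le y_{c,t}\le 1$ for all $c\in\mathcal{C}$, $t\in\mathcal{T}$, there exists $x\in\mathbb{R}^{\mathcal{C}\times\mathcal{T}}$ with $x_{c,t}\in\{0,1\}$ for all $c\in\mathcal{C}$, $t\in\mathcal{T}$ such that $$\Big\lfloor \sum_{i=1}^t y_{c,i}\Big\rfloor \le \sum_{i=1}^t x_{c,i} \le \Big\lceil \sum_{i=1}^t y_{c,i}\Big\rceil \quad\text{for every } c\in\mathcal{C},\ t\in\mathcal{T},$$ $$\Big|\sum_{c\in\mathcal{C}} E_c x_{c,t} - \sum_{c\in\mathcal{C}} E_c y_{c,t}\Big| \le \max_{c\in\mathcal{C}}|E_c| \quad\text{for every } t\in\mathcal{T},$$ and such an $x$ can be computed from $y$ in time $\mathcal{O}(T^2C^2)$. *)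

(* Defs.v *)
From HB Require Import structures.
From mathcomp Require Import all_boot all_order all_algebra.
From mathcomp Require Import reals.

Set Implicit Arguments.
Unset Strict Implicit.
Unset Printing Implicit Defensive.

Import Order.TTheory GRing.Theory Num.Theory.

Local Open Scope ring_scope.

(* Indices are 0-based, so [\sum_(i < T | i <= t)] has [t.+1] terms and is the
   sum over the first t+1 time points. The default value 0 of the maximum is
   immaterial: the norms are nonnegative and [C] is positive wherever this is
   used. *)
Definition is_rounding (R : realType) (C T : nat)
    (E : 'I_C -> R) (y x : 'M[R]_(C, T)) : Prop :=
  [/\ forall c t, x c t = 0 \/ x c t = 1,
      forall (c : 'I_C) (t : 'I_T),
        (Num.floor (\sum_(i < T | (i <= t)%N) y c i))%:~R
          <= \sum_(i < T | (i <= t)%N) x c i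
          <= (Num.ceil (\sum_(i < T | (i <= t)%N) y c i))%:~R
    & forall t : 'I_T,
        `| \sum_(c < C) E c * x c t - \sum_(c < C) E c * y c t |
          <= \big[Num.max/0]_(c < C) `|E c| ].

(* Running time is measured on a real RAM: exact real arithmetic and exact
   comparison of reals at unit cost, as in the usual analysis of algorithms
   on real data. The memory consists of arrays of naturals and arrays of reals;
   the name of an array is a literal of the program, the index into it is
   computed at run time. To keep unit cost honest, naturals (used for indexing
   and control) have only addition and truncated subtraction, there is no floor
   or any other passage from reals to naturals, and the only real literals are
   naturals. *)
Inductive nexp : Type :=
| NConst of nat
| NGet of nat & nexp
| NAdd of nexp & nexp
| NSub of nexp & nexp.

Inductive rexp : Type :=
| RConst of nat
| RGet of nat & nexp
| RAdd of rexp & rexp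
| RSub of rexp & rexp
| RMul of rexp & rexp
| RDiv of rexp & rexp.

Inductive bexp : Type :=
| NLe of nexp & nexp
| RLe of rexp & rexp
| BNot of bexp
| BAnd of bexp & bexp.

(* [NSet a i e] and [RSet a i e] store the value of [e] in cell [i] of the
   array [a]. *)
Inductive cmd : Type :=
| Skip
| NSet of nat & nexp & nexp
| RSet of nat & nexp & rexp
| Seq of cmd & cmd
| If of bexp & cmd & cmd
| While of bexp & cmd.

Record state (R : Type) := State {
  nmem : nat -> nat -> nat;
  rmem : nat -> nat -> R }.

Definition upd (V : Type) (m : nat -> nat -> V) (a i : nat) (v : V) :
    nat -> nat -> V :=
  fun b j => if (b == a) && (j == i) then v else m b j.

Fixpoint neval (R : Type) (s : state R) (e : nexp) : nat :=
  match e with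
  | NConst n => n
  | NGet a i => nmem s a (neval s i)
  | NAdd e1 e2 => neval s e1 + neval s e2
  | NSub e1 e2 => neval s e1 - neval s e2
  end%N.

(* As everywhere in the library, division by 0 yields 0. *)
Fixpoint reval (R : realType) (s : state R) (e : rexp) : R :=
  match e with
  | RConst n => n%:R
  | RGet a i => rmem s a (neval s i)
  | RAdd e1 e2 => reval s e1 + reval s e2
  | RSub e1 e2 => reval s e1 - reval s e2
  | RMul e1 e2 => reval s e1 * reval s e2
  | RDiv e1 e2 => reval s e1 / reval s e2
  end.

Fixpoint beval (R : realType) (s : state R) (b : bexp) : bool :=
  match b with
  | NLe e1 e2 => (neval s e1 <= neval s e2)%N
  | RLe e1 e2 => reval s e1 <= reval s e2
  | BNot b1 => ~~ beval s b1
  | BAnd b1 b2 => beval s b1 && beval s b2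
  end.

(* Evaluating an expression costs 1 for each of its operations, memory
   accesses and literals. *)
Fixpoint ncost (e : nexp) : nat :=
  match e with
  | NConst _ => 1
  | NGet _ i => (ncost i).+1
  | NAdd e1 e2 | NSub e1 e2 => (ncost e1 + ncost e2).+1
  end%N.

Fixpoint rcost (e : rexp) : nat :=
  match e with
  | RConst _ => 1
  | RGet _ i => (ncost i).+1
  | RAdd e1 e2 | RSub e1 e2 | RMul e1 e2 | RDiv e1 e2 =>
      (rcost e1 + rcost e2).+1
  end%N.

Fixpoint bcost (b : bexp) : nat :=
  match b with
  | NLe e1 e2 => (ncost e1 + ncost e2).+1
  | RLe e1 e2 => (rcost e1 + rcost e2).+1
  | BNot b1 => (bcost b1).+1
  | BAnd b1 b2 => (bcost b1 + bcost b2).+1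
  end%N.

(* [exec p s n s']: started in [s], the program [p] halts in [s'] after
   exactly [n] time units. *)
Inductive exec (R : realType) : cmd -> state R -> nat -> state R -> Prop :=
| ExecSkip s :
    exec Skip s 1 s
| ExecNSet a i e s :
    exec (NSet a i e) s (ncost i + ncost e).+1
      (State (upd (nmem s) a (neval s i) (neval s e)) (rmem s))
| ExecRSet a i e s :
    exec (RSet a i e) s (ncost i + rcost e).+1
      (State (nmem s) (upd (rmem s) a (neval s i) (reval s e)))
| ExecSeq p q s1 s2 s3 m n :
    exec p s1 m s2 -> exec q s2 n s3 -> exec (Seq p q) s1 (m + n)%N s3
| ExecIfTrue b p q s s' n :
    beval s b -> exec p s n s' -> exec (If b p q) s (bcost b + n).+1 s'
| ExecIfFalse b p q s s' n :
    ~~ beval s b -> exec q s n s' -> exec (If b p q) s (bcost b + n).+1 s'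
| ExecWhileTrue b p s1 s2 s3 m n :
    beval s1 b -> exec p s1 m s2 -> exec (While b p) s2 n s3 ->
    exec (While b p) s1 (bcost b + m + n).+1 s3
| ExecWhileFalse b p s :
    ~~ beval s b -> exec (While b p) s (bcost b).+1 s.

Definition at_nat (R : realType) (n : nat) (f : 'I_n -> R) (k : nat) : R :=
  if insub k is Some i then f i else 0.

(* Input layout: cells 0 and 1 of the natural array 0 hold [C] and [T], the
   real array 0 holds [E], the real array 1 holds [y] in row-major order, and
   all other cells are 0. *)
Definition init (R : realType) (C T : nat)
    (E : 'I_C -> R) (y : 'M[R]_(C, T)) : state R :=
  State
    (fun a k => match a, k with 0, 0 => C | 0, 1 => T | _, _ => 0 end%N)
    (fun a k => match a with
                | 0%N => at_nat E k
                | 1%N => at_nat (fun c => at_nat (y c) (k %% T)%N) (k %/ T)%N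
                | _ => 0
                end).

(* The output is read off the real array 2, again in row-major order. *)
Definition computes_within (R : realType) (C T : nat) (p : cmd)
    (E : 'I_C -> R) (y x : 'M[R]_(C, T)) (N : nat) : Prop :=
  exists (n : nat) (s : state R),
    [/\ exec p (init E y) n s,
        (n <= N)%N
      & forall (c : 'I_C) (t : 'I_T), rmem s 2 (c * T + t)%N = x c t].

(* Main.v *)
Require Import Defs.
From HB Require Import structures.
From mathcomp Require Import all_boot all_order all_algebra.
From mathcomp Require Import reals.
From mathcomp Require Import zify ring lra.

Set Implicit Arguments.
Unset Strict Implicit.
Unset Printing Implicit Defensive.

Import Order.TTheory GRing.Theory Num.Theory.

(* Extend every row by a virtual column T that makes its sum an integer, and let
   z_{c,t} in [0,1) be the fractional part of the sum of the y_{c,i} with i < t.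
   Then y_{c,t} = d_{c,t} + z_{c,t+1} - z_{c,t} with d_{c,t} in {0,1}. With d
   fixed, modify x = y through z: if only non-integral z's move, and stay in
   [0,1], then the prefix sums stay between floor and ceiling.
   Call a column t < T protected as long as it has two fractional entries.
   Shifting 1/E_c between two fractional entries of row c with only non-integral
   z's between them carries one unit of sum_c E_c x_{c,t} from one column to
   another. Every fractional entry has such a partner in its row, and a protected
   column entered in one row can be left in another one; hence a walk along such
   shifts, started in an unprotected column if possible, either returns to a
   column it has visited or joins two unprotected columns. Following this
   circulation until some x or z becomes integral changes no weighted sum of a
   protected column. A column that ceases to be protected has at most one
   fractional entry c left, so its weighted sum ends up off by at most |E_c|.
   A step takes time O(TC), and there are at most 2(T+1)C of them. *)

Local Open Scope nat_scope.

Arguments nmem {R} _ (_ _)%_nat_scope.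
Arguments rmem {R} _ (_ _)%_nat_scope.
Arguments upd {V} _ (_ _)%_nat_scope _ (_ _)%_nat_scope.

(** * For-programs and their running time *)

Inductive prog : Type :=
| PN of nat & nexp & nexp
| PR of nat & nexp & rexp
| PSeq of prog & prog
| PIf of bexp & prog & prog
| PSkip
| PFor of nat & nat & nat & prog.

(* [PFor v k m p] runs [p] with the counter (cell 0 of the natural array [v])
   ranging over [0, ..., n - 1], where [n] is [m] plus cell [k] of the natural
   array 0. *)
Fixpoint compile (p : prog) : cmd :=
  match p with
  | PN a i e => NSet a i e
  | PR a i e => RSet a i e
  | PSeq p q => Seq (compile p) (compile q)
  | PIf b p q => If b (compile p) (compile q)
  | PSkip => Skip
  | PFor v k m p =>
      Seq (NSet v (NConst 0) (NConst 0))
          (While (NLe (NAdd (NGet v (NConst 0)) (NConst 1))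
                      (NAdd (NGet 0 (NConst k)) (NConst m)))
             (Seq (compile p)
                (NSet v (NConst 0) (NAdd (NGet v (NConst 0)) (NConst 1)))))
  end.

Fixpoint nwrites (p : prog) : seq nat :=
  match p with
  | PN a _ _ => [:: a]
  | PSeq p q | PIf _ p q => nwrites p ++ nwrites q
  | PFor v _ _ p => v :: nwrites p
  | _ => [::]
  end.

Fixpoint rwrites (p : prog) : seq nat :=
  match p with
  | PR a _ _ => [:: a]
  | PSeq p q | PIf _ p q => rwrites p ++ rwrites q
  | PFor _ _ _ p => rwrites p
  | _ => [::]
  end.

(* The input array 0 is read-only, bounds are read off its cells 0 and 1, and
   a loop body does not touch its own counter. *)
Fixpoint wf (p : prog) : bool :=
  match p with
  | PN a _ _ => a != 0
  | PSeq p q | PIf _ p q => wf p && wf q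
  | PFor v k _ p => [&& v != 0, (k < 2), v \notin nwrites p & wf p]
  | _ => true
  end.

Fixpoint degC (p : prog) : nat :=
  match p with
  | PSeq p q | PIf _ p q => maxn (degC p) (degC q)
  | PFor _ k _ p => ((k == 0) + degC p)
  | _ => 0
  end.

Fixpoint degT (p : prog) : nat :=
  match p with
  | PSeq p q | PIf _ p q => maxn (degT p) (degT q)
  | PFor _ k _ p => ((k != 0) + degT p)
  | _ => 0
  end.

Fixpoint coef (p : prog) : nat :=
  match p with
  | PN _ i e => (ncost i + ncost e).+1
  | PR _ i e => (ncost i + rcost e).+1
  | PSeq p q => coef p + coef q
  | PIf b p q => (bcost b + (coef p + coef q)).+1
  | PSkip => 1
  | PFor _ _ m p => 13 + m.+1 * (coef p + 16)
  end.

Arguments PN _%_nat_scope _ _.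
Arguments PR _%_nat_scope _ _.
Arguments PFor (_ _ _)%_nat_scope _.

Section Semantics.
Variable R : realType.
Implicit Types (s : state R) (p q : prog).

Definition setn v n s := State (upd (nmem s) v 0 n) (rmem s).

(** The bound of a loop is read once on entry, whereas the compiled loop rereads it in every round.
    The two agree because [wf] protects the natural array 0. *)
Fixpoint run p s : state R :=
  match p with
  | PN a i e => State (upd (nmem s) a (neval s i) (neval s e)) (rmem s)
  | PR a i e => State (nmem s) (upd (rmem s) a (neval s i) (reval s e))
  | PSeq p q => run q (run p s)
  | PIf b p q => if beval s b then run p s else run q s
  | PSkip => s
  | PFor v k m p =>
      iter (nmem s 0 k + m)
        (fun s => let s1 := run p s in setn v (nmem s1 v 0).+1 s1)
        (setn v 0 s)
  end.

Lemma run_nmem p s a : a \notin nwrites p -> nmem (run p s) a = nmem s a.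
Proof.
elim: p s => [b i e|b i e|p IHp q IHq|b p IHp q IHq||v k m p IHp] s //=.
- by rewrite inE => /negPf h; rewrite /upd h.
- by rewrite mem_cat => /norP[ap aq]; rewrite IHq // IHp.
- by rewrite mem_cat => /norP[ap aq]; case: ifP => _; [apply: IHp|apply: IHq].
- rewrite inE => /norP[/negPf av ap].
  by elim: (_ + _) => [|n IHn] /=; rewrite /upd ?av // IHp.
Qed.

Lemma run_rmem p s a : a \notin rwrites p -> rmem (run p s) a = rmem s a.
Proof.
elim: p s => [b i e|b i e|p IHp q IHq|b p IHp q IHq||v k m p IHp] s //=.
- by rewrite inE => /negPf h; rewrite /upd h.
- by rewrite mem_cat => /norP[ap aq]; rewrite IHq // IHp.
- by rewrite mem_cat => /norP[ap aq]; case: ifP => _; [apply: IHp|apply: IHq].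
- by move=> ap; elim: (_ + _) => [|n IHn] //=; rewrite IHp.
Qed.

Lemma wf_nwrites p : wf p -> 0 \notin nwrites p.
Proof.
elim: p => [b i e|b i e|p IHp q IHq|b p IHp q IHq||v k m p IHp] //=.
- by rewrite inE eq_sym.
- by case/andP=> /IHp ? /IHq ?; rewrite mem_cat negb_or; apply/andP.
- by case/andP=> /IHp ? /IHq ?; rewrite mem_cat negb_or; apply/andP.
- by case/and4P=> v0 _ _ /IHp ?; rewrite inE negb_or eq_sym v0.
Qed.

(** Invariant rule for counted loops, by induction on the number of finished rounds. The induction
    carries the value of the counter and the frame conditions along, so that every use gets them for
    free. *)
Lemma run_for (I : nat -> state R -> Prop) v k m p s :
  v \notin nwrites p -> v != 0 -> 0 \notin nwrites p ->
  I 0 (setn v 0 s) ->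
  (forall j s', (j < nmem s 0 k + m) -> nmem s' v 0 = j ->
     (forall a, a \notin v :: nwrites p -> nmem s' a = nmem s a) ->
     (forall a, a \notin rwrites p -> rmem s' a = rmem s a) ->
     I j s' -> I j.+1 (setn v j.+1 (run p s'))) ->
  I (nmem s 0 k + m) (run (PFor v k m p) s).
Proof.
move=> vp v0 p0 I0 IS /=; set f := fun s : state R => _.
suff H : forall n, (n <= nmem s 0 k + m) ->
  [/\ nmem (iter n f (setn v 0 s)) v 0 = n,
     (forall a, a \notin v :: nwrites p ->
        nmem (iter n f (setn v 0 s)) a = nmem s a),
     (forall a, a \notin rwrites p ->
        rmem (iter n f (setn v 0 s)) a = rmem s a)
   & I n (iter n f (setn v 0 s))] by case: (H _ (leqnn _)).
elim=> [|n IHn] hn.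
  split=> //=; first by rewrite /upd !eqxx.
  by move=> a; rewrite inE => /norP[/negPf av _]; rewrite /upd av.
have [h1 h2 h3 h4] := IHn (ltnW hn).
set s' := iter n f _ in h1 h2 h3 h4 *.
rewrite iterS -/s' {1 2 3 4}/f /= run_nmem // h1; split.
- by rewrite /= /upd !eqxx.
- move=> a; rewrite inE => /norP[/negPf av ap] /=; rewrite /upd av /=.
  by rewrite run_nmem // h2 // inE av.
- by move=> a ap /=; rewrite run_rmem // h3.
- exact: IS.
Qed.

(* For positive [C] and [T], a polynomial in them is at most the sum of its
   coefficients times [C ^ i * T ^ j], where [i] and [j] are its partial degrees. *)
Lemma exec_compile p s : wf p -> (0 < nmem s 0 0) -> (0 < nmem s 0 1) ->
  exists n, exec (compile p) s n (run p s) /\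
    (n <= coef p * (nmem s 0 0 ^ degC p * nmem s 0 1 ^ degT p)).
Proof.
have cat_le C T a b (d1 d2 e1 e2 : nat) n1 n2 : (0 < C) -> (0 < T) ->
    (n1 <= a * (C ^ d1 * T ^ e1)) -> (n2 <= b * (C ^ d2 * T ^ e2)) ->
    (n1 <= a * (C ^ maxn d1 d2 * T ^ maxn e1 e2)) /\
    (n2 <= b * (C ^ maxn d1 d2 * T ^ maxn e1 e2)).
  move=> C0 T0 h1 h2; split; [apply: (leq_trans h1)|apply: (leq_trans h2)];
  by rewrite leq_mul2l; apply/orP; right; apply: leq_mul;
     rewrite leq_pexp2l // ?leq_maxl ?leq_maxr.
elim: p s => [b i e|b i e|p IHp q IHq|b p IHp q IHq||v k m p IHp] s /=.
- by move=> _ _ _; eexists; split; [constructor|rewrite !expn0 !muln1].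
- by move=> _ _ _; eexists; split; [constructor|rewrite !expn0 !muln1].
- case/andP=> wp wq C0 T0.
  have p0 := run_nmem s (wf_nwrites wp).
  have [n1 [e1 l1]] := IHp s wp C0 T0.
  have := IHq (run p s) wq; rewrite p0 => /(_ C0 T0) [n2 [e2 l2]].
  exists (n1 + n2); split; first by econstructor; eauto.
  have [] := cat_le _ _ _ _ _ _ _ _ _ _ C0 T0 l1 l2.
  by rewrite mulnDl; apply: leq_add.
- case/andP=> wp wq C0 T0.
  have [n1 [e1 l1]] := IHp s wp C0 T0.
  have [n2 [e2 l2]] := IHq s wq C0 T0.
  have [{}l1 {}l2] := cat_le _ _ _ _ _ _ _ _ _ _ C0 T0 l1 l2.
  set D := (nmem s 0 0 ^ _ * _) in l1 l2 *.
  have D0 : (0 < D) by rewrite muln_gt0 !expn_gt0 C0 T0.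
  case: (boolP (beval s b)) => hb.
    exists (bcost b + n1).+1; split; first by constructor.
    nia.
  exists (bcost b + n2).+1; split; first by constructor.
  nia.
- by move=> _ _ _; exists 1; split=> //; constructor.
- case/and4P=> v0 k2 vp wp C0 T0.
  set f := fun s : state R => _.
  set N := (nmem s 0 k + m).
  set D := (nmem s 0 0 ^ degC p * nmem s 0 1 ^ degT p).
  have D0 : (0 < D) by rewrite muln_gt0 !expn_gt0 C0 T0.
  set W := While _ _.
  (* [d] counts the remaining rounds. The failing last test costs 10; a round costs its body plus
     16, namely 9 for the test, 6 for the counter and 1 for the loop. With 3 for resetting the
     counter, this explains the 13 and the 16 in [coef]. *)
  suff H : forall d s', nmem s' 0 = nmem s 0 -> (nmem s' v 0 + d = N) ->
    exists n, exec W s' n (iter d f s') /\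
      (n <= 10 + d * (coef p * D + 16)).
    have i1 : nmem (setn v 0 s) 0 = nmem s 0.
      by rewrite /= /upd [0 == v]eq_sym (negPf v0).
    have i2 : (nmem (setn v 0 s) v 0 + N = N) by rewrite /= /upd !eqxx.
    have [n [en ln]] := H N _ i1 i2.
    exists (3 + n); split; first by econstructor; [constructor|].
    have {}ln : (3 + n <= 13 + N * (coef p * D + 16)) by lia.
    have hN : (N <= m.+1 * nmem s 0 k).
      by rewrite /N; case: (k) k2 => [|[|//]] _; nia.
    have -> : (nmem s 0 0 ^ ((k == 0) + degC p) *
               nmem s 0 1 ^ ((k != 0) + degT p) = nmem s 0 k * D).
      by case: (k) k2 => [|[|//]] _ /=; rewrite /D !add0n !expnS; lia.
    have k0 : (0 < nmem s 0 k) by case: (k) k2 => [|[|//]].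
    set B := nmem s 0 k in hN k0 *.
    apply: (leq_trans ln).
    have h1 : (N * (coef p * D + 16) <= m.+1 * B * (coef p * D + 16)).
      by rewrite leq_mul2r hN orbT.
    have h2 : (coef p * D + 16 <= (coef p + 16) * D) by nia.
    have h3 : (m.+1 * B * (coef p * D + 16) <= m.+1 * B * ((coef p + 16) * D)).
      by rewrite leq_mul2l h2 orbT.
    apply: (leq_trans (leq_add (leqnn 13) h1)).
    apply: (leq_trans (leq_add (leqnn 13) h3)).
    have : (13 <= 13 * (B * D)) by rewrite leq_pmulr // muln_gt0 k0.
    by lia.
  elim=> [|d IHd] s' s0 sd.
    exists 10; split=> //.
    by apply: ExecWhileFalse => /=; rewrite s0 -/N; lia.
  have hb : (nmem s' v 0 + 1 <= nmem s' 0 k + m) by rewrite s0 -/N; lia.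
  have := IHp s' wp; rewrite s0 -/D => /(_ C0 T0) [n1 [e1 l1]].
  have q0 : nmem (f s') 0 = nmem s 0.
    by rewrite /f /= /upd [0 == v]eq_sym (negPf v0) /= run_nmem ?wf_nwrites.
  have qv : (nmem (f s') v 0 + d = N).
    by rewrite /f /= /upd !eqxx /= run_nmem //; lia.
  have [n2 [e2 l2]] := IHd _ q0 qv.
  exists (9 + (n1 + 6) + n2).+1; split.
    rewrite iterSr; apply: ExecWhileTrue e2 => //; apply: ExecSeq e1 _.
    have := ExecNSet v (NConst 0) (NAdd (NGet v (NConst 0)) (NConst 1)) (run p s').
    by rewrite /= [(nmem _ v 0 + 1)]addn1.
  by lia.
Qed.

End Semantics.

Arguments setn {R} (_ _)%_nat_scope _.

Local Open Scope ring_scope.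

(** * Circulations along walks *)

Section Rounding.
Variable R : realType.
Implicit Types (v d : R).

Definition frac v := (0 < v) && (v < 1).

Lemma frac_split v : 0 <= v <= 1 -> frac v = false -> v = 0 \/ v = 1.
Proof.
rewrite /frac !le_eqVlt => /andP[/orP[/eqP<-|v0]]; first by left.
by case/orP=> [/eqP->|v1]; [right|rewrite v0 v1].
Qed.

(** Modulo 1 the relation reads [x = n - z]: a fractional [x] needs a fractional [n] or [z], and an
    integral [x] makes [n] and [z] congruent. This is why the fractional entries of a row have
    partners. *)
Lemma frac_link (x d n z : R) : d = 0 \/ d = 1 -> 0 <= x <= 1 ->
  0 <= n <= 1 -> 0 <= z <= 1 -> x = d + n - z ->
  (frac x -> frac z || frac n) /\ (frac x = false -> frac z = frac n).
Proof.
move=> d01 x01 n01 z01 e; split=> fx.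
  apply: contraT => /norP[/negbTE/(frac_split z01) hz /negbTE/(frac_split n01) hn].
  by case/andP: fx => ? ?; case: d01 => ?; case: hz => ?; case: hn => ?; lra.
have {}fx := frac_split x01 fx; apply/idP/idP => /andP[f1 f2]; apply: contraT => h.
  have {}h := frac_split n01 (negbTE h).
  by case: d01 => ?; case: fx => ?; case: h => ?; lra.
have {}h := frac_split z01 (negbTE h).
by case: d01 => ?; case: fx => ?; case: h => ?; lra.
Qed.

Section Direction.
Variables (C T : nat) (E : nat -> R) (X Z : nat -> nat -> R).
Variable prot : nat -> bool.
Variable P : nat -> nat -> nat.
Hypothesis E0 : forall c, (c < C)%N -> E c != 0.

(* [prot] marks the protected columns, and [Z c t] is the fractional part of the
   sum of row [c] before column [t]. *)
Definition partner_ok c t :=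
  [/\ (P c t <= T)%N, P c t != t, frac (X c (P c t))
    & forall u, (minn t (P c t) < u <= maxn t (P c t))%N -> frac (Z c u)].

(** [W] moves x and [DZ] moves z. A zero row sum expresses that the value after the virtual column,
    which is 0, stays where it is. *)
Definition direction (W DZ : nat -> nat -> R) :=
  [/\ forall c t, (c < C)%N -> (t <= T)%N -> W c t != 0 -> frac (X c t),
      forall c t, (c < C)%N -> (t <= T)%N -> DZ c t != 0 -> frac (Z c t),
      forall c, (c < C)%N -> \sum_(u < T.+1) W c u = 0
    & forall t, (t <= T)%N -> prot t -> \sum_(c < C) E c * W c t = 0].

(* The [k]-th edge of the walk leaves column [es k] in row [ec k]; it arrives at
   the partner of that entry. *)
Variables (ec es : nat -> nat).

Definition walk n :=
  [/\ forall k, (k < n)%N ->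
        [/\ (ec k < C)%N, (es k <= T)%N & frac (X (ec k) (es k))],
      forall k, (k.+1 < n)%N ->
        [/\ P (ec k) (es k) = es k.+1, ec k != ec k.+1 & prot (es k.+1)]
    & forall k l, (k < n)%N -> (l < n)%N -> es k = es l -> k = l].

Definition arrival k := P (ec k) (es k).

(** The edges before [k0] are the tail that leads into the cycle; they carry no flow. A walk between
    two unprotected columns is used from its first edge on. *)
Definition closed_walk k0 K :=
  [/\ (k0 < K)%N, walk K & arrival K.-1 = es k0 \/
      [/\ k0 = 0%N, ~~ prot (arrival K.-1) & ~~ prot (es 0)]].

(** The factor [1 / E c] makes one unit of weighted sum leave the arrival column and enter the
    departure column, whatever the row. *)
Definition flow_at k c t : R :=
  if ec k == c then (E c)^-1 * ((es k == t)%:R - (arrival k == t)%:R) else 0.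

Definition flow k0 K c t : R := \sum_(k0 <= k < K) flow_at k c t.

Lemma flow_neq0 k0 K (f : nat -> R) : \sum_(k0 <= k < K) f k != 0 ->
  exists2 k, (k0 <= k < K)%N & f k != 0.
Proof.
move=> h; case: (boolP (has (fun k => f k != 0) (index_iota k0 K))).
  by case/hasP=> k; rewrite mem_index_iota => kk fk; exists k.
move/hasPn=> hn; case/eqP: h; rewrite big_seq_cond big1 // => k.
by rewrite andbT => /hn; rewrite negbK => /eqP.
Qed.

(** The two ends of an edge cancel in every prefix that contains both or neither. What remains is
    supported on the range that [partner_ok] requires to be fractional. *)
Lemma flow_prefix k0 K c t : \sum_(u < t) flow k0 K c u =
  \sum_(k0 <= k < K) (if ec k == c then
     (E c)^-1 * ((es k < t)%:R - (arrival k < t)%:R) else 0).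
Proof.
rewrite exchange_big /=; apply: eq_bigr => k _.
rewrite /flow_at; case: eqP => _; last by rewrite big1.
rewrite -big_distrr /= sumrB.
have H (a : nat) : \sum_(u < t) (a == u)%:R = (a < t)%:R :> R.
  case: ltnP => at_; last by rewrite big1 // => u _; case: eqP => // ?;
    have := ltn_ord u; lia.
  rewrite (bigD1 (Ordinal at_)) //= eqxx big1 ?addr0 // => u.
  by rewrite -val_eqE /= eq_sym => /negPf->.
by rewrite !H.
Qed.

(** Each arrival is the next departure, so only the first departure and the last arrival survive. *)
Lemma telescope_walk k0 K t : (k0 < K)%N -> walk K ->
  \sum_(k0 <= k < K) ((es k == t)%:R - (arrival k == t)%:R) =
  (es k0 == t)%:R - (arrival K.-1 == t)%:R :> R.
Proof.
case: K => // K; rewrite ltnS => kK [_ w _] /=.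
rewrite big_nat_recr //=.
have -> : \sum_(k0 <= k < K) ((es k == t)%:R - (arrival k == t)%:R) =
          \sum_(k0 <= k < K) - ((es k.+1 == t)%:R - (es k == t)%:R) :> R.
  apply: eq_big_nat => k /andP[_ kK']; rewrite opprB.
  by have [|<- _ _] := w k; rewrite ?ltnS.
by rewrite sumrN telescope_sumr //; ring.
Qed.

(** The support conditions and the row sums are checked edge by edge. In a protected column the
    factors [E c] cancel and the weighted sum telescopes to the two ends of the walk, which coincide
    or are unprotected. *)
Lemma flow_direction k0 K :
  (forall c t, (c < C)%N -> (t <= T)%N -> frac (X c t) -> partner_ok c t) ->
  closed_walk k0 K ->
  direction (flow k0 K) (fun c t => \sum_(u < t) flow k0 K c u) /\
  exists c t, [/\ (c < C)%N, (t <= T)%N & flow k0 K c t != 0].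
Proof.
move=> pok [kK wK term]; have [w1 w2 w3] := wK.
have pk k : (k < K)%N -> partner_ok (ec k) (es k).
  by move=> /w1[*]; apply: pok.
split; first split.
- move=> c t cC tT /flow_neq0[k /andP[_ /[dup] kK' /w1[_ _ fk]]].
  have [_ _ fa _] := pk _ kK'.
  rewrite /flow_at; case: (ec k =P c) => [<-|_]; last by rewrite eqxx.
  case: (es k =P t) => [<- //|_]; rewrite /arrival.
  by case: (P _ _ =P t) => [<- //|_]; rewrite subrr mulr0 eqxx.
- move=> c t cC tT; rewrite flow_prefix => /flow_neq0[k /andP[_ kK']].
  case: (ec k =P c) => [<-|_]; last by rewrite eqxx.
  have [_ _ _ fz] := pk _ kK' => h; apply: fz.
  move: h; rewrite -/(arrival k).
  by case: ltnP => ?; case: ltnP => ?; rewrite ?subrr ?mulr0 ?eqxx //; lia.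
- move=> c cC; rewrite flow_prefix big_nat big1 // => k /andP[_ kK'].
  case: ifP => // _; have [_ sT _] := w1 _ kK'; have [aT _ _ _] := pk _ kK'.
  by rewrite !ltnS sT /arrival aT subrr mulr0.
- move=> t tT pt.
  transitivity (\sum_(k0 <= k < K) ((es k == t)%:R - (arrival k == t)%:R) : R).
    under eq_bigr do rewrite /flow big_distrr /=.
    rewrite exchange_big /=; apply: eq_big_nat => k /andP[_ /w1[cC _ _]].
    rewrite (bigD1 (Ordinal cC)) //= /flow_at eqxx mulrA divff ?E0 // mul1r.
    rewrite big1 ?addr0 // => c; rewrite -val_eqE /= eq_sym => /negPf->.
    by rewrite mulr0.
  rewrite telescope_walk //.
  case: term => [->|[k00 na n0]]; first by rewrite subrr.
  rewrite k00; case: eqP => [e|_]; first by rewrite e pt in n0.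
  by case: eqP => [e|_]; [rewrite e pt in na|rewrite subrr].
(* With at least two edges, the entry left by edge [k0.+1] serves as witness. Departure columns are
   distinct, and edge [k0] enters this column in another row, so no other edge touches the entry.
   The entry left by edge [k0] would not do: the closing edge may return to it in the same row and
   cancel its flow. *)
case: (ltnP k0.+1 K) => [k1K|Kk1].
  have [arr ne pr] := w2 _ k1K; have [cC sT _] := w1 _ k1K.
  exists (ec k0.+1), (es k0.+1); split=> //.
  rewrite /flow (big_cat_nat (n := k0.+1)) //= big_nat1.
  rewrite (big_cat_nat (n := k0.+2)) //= big_nat1.
  rewrite big_nat big1 => [|k /andP[k0k kK']]; last first.
    rewrite /flow_at; case: ifP => // _.
    case: eqP => [/w3 e|_]; first by have := e kK' k1K; lia.
    case: eqP => [ea|_]; last by rewrite subrr mulr0.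
    case: (ltnP k.+1 K) => [k2|k2].
      have [a2 _ _] := w2 _ k2; move: ea; rewrite /arrival a2 => /w3 e.
      by have := e k2 k1K; lia.
    have kE : K.-1 = k by lia.
    case: term => [|[_ ]]; rewrite kE ea; last by rewrite pr.
    by move=> /w3 e; have := e k1K kK; lia.
  rewrite /flow_at (negPf ne) eqxx add0r addr0 eqxx.
  case: (arrival _ =P _) => [ea|_]; last by rewrite /= subr0 mulr1 invr_neq0 ?E0.
  by have [_] := pk _ k1K; rewrite -/(arrival _) ea eqxx.
have k0K : K = k0.+1 by lia.
have [cC sT _] := w1 _ kK.
exists (ec k0), (es k0); split=> //.
rewrite /flow k0K big_nat1 /flow_at !eqxx.
case: (arrival _ =P _) => [ea|_]; last by rewrite /= subr0 mulr1 invr_neq0 ?E0.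
by have [_] := pk _ kK; rewrite -/(arrival _) ea eqxx.
Qed.

End Direction.

(** The two ratios are the reciprocals of the signed steps at which [v] reaches 1 and 0, so a [mu]
    above both keeps the step [1 / mu] short enough. *)
Lemma move_bound v d mu : 0 <= v <= 1 -> (d != 0 -> frac v) -> 0 <= mu ->
  d / (1 - v) <= mu -> - d / v <= mu -> 0 <= v + d / mu <= 1.
Proof.
move=> v01 fv mu0 h1 h2; have [->|d0] := eqVneq d 0; first by rewrite mul0r addr0.
have [->|m0] := eqVneq mu 0; first by rewrite invr0 mulr0 addr0.
have mup : 0 < mu by rewrite lt_def m0.
have /andP[v0 v1] := fv d0.
have u0 : 0 < 1 - v by rewrite subr_gt0.
move: h1 h2; rewrite !ler_pdivrMr // => h1 h2.
have k1 : d / mu <= 1 - v by rewrite ler_pdivrMr // mulrC.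
have k2 : - d / mu <= v by rewrite ler_pdivrMr // mulrC.
by rewrite mulNr in k2; lra.
Qed.

Lemma move_frac v d mu : (d != 0 -> frac v) -> frac (v + d / mu) -> frac v.
Proof.
by move=> fv; have [->|/fv->//] := eqVneq d 0; rewrite mul0r addr0.
Qed.

(** If [mu] is one of the ratios, the value lands exactly on 1 or on 0. Since [mu] is nonzero, [d]
    is too, so the value was fractional before. *)
Lemma move_tight v d mu : (d != 0 -> frac v) -> mu != 0 ->
  mu = d / (1 - v) \/ mu = - d / v -> frac v /\ ~~ frac (v + d / mu).
Proof.
move=> fv m0 h; have d0 : d != 0.
  by apply: contraNneq m0 => d0; case: h => ->; rewrite d0 ?oppr0 mul0r.
have /andP[v0 v1] := fv d0; split; first exact: fv.
have u0 : 1 - v != 0 by rewrite subr_eq0 eq_sym lt_eqF.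
have w0 : v != 0 by rewrite gt_eqF.
rewrite /frac; case: h => ->.
  by have -> : v + d / (d / (1 - v)) = 1; [field; apply/andP|rewrite ltxx andbF].
by have -> : v + d / (- d / v) = 0; [field; apply/andP|rewrite ltxx].
Qed.

Lemma move_pos v d mu : frac v -> d != 0 ->
  d / (1 - v) <= mu -> - d / v <= mu -> 0 < mu.
Proof.
move=> /andP[v0 v1] d0 h1 h2; have u0 : 0 < 1 - v by rewrite subr_gt0.
case: (ltrgtP d 0) d0 => // dd _.
  by apply: lt_le_trans h2; rewrite divr_gt0 // oppr_gt0.
by apply: lt_le_trans h1; rewrite divr_gt0.
Qed.

(** Pigeonhole on the distinct departure columns; hence [T.+1] rounds suffice to close a walk. *)
Lemma walk_size (C T : nat) X prot P ec es n :
  walk C T X prot P ec es n -> (n <= T.+1)%N.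
Proof.
move=> [w1 _ w3]; rewrite -(size_iota 0 n) -(size_map es) -(size_iota 0 T.+1).
apply: uniq_leq_size.
  rewrite map_inj_in_uniq ?iota_uniq // => k l.
  by rewrite !mem_iota !add0n; apply: w3.
move=> t /mapP[k]; rewrite !mem_iota !add0n => kn ->.
by have [] := w1 k kn.
Qed.

Lemma walk_rcons (C T : nat) X prot P ec es ec' es' n :
  walk C T X prot P ec es n.+1 ->
  (forall k, (k <= n)%N -> ec' k = ec k /\ es' k = es k) ->
  (ec' n.+1 < C)%N -> (es' n.+1 <= T)%N -> frac (X (ec' n.+1) (es' n.+1)) ->
  P (ec n) (es n) = es' n.+1 -> ec n != ec' n.+1 -> prot (es' n.+1) ->
  (forall k, (k <= n)%N -> es k <> es' n.+1) ->
  walk C T X prot P ec' es' n.+2.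
Proof.
move=> [w1 w2 w3] e eC eT eF eP ne pr fresh; split.
- move=> k; rewrite ltnS leq_eqVlt => /orP[/eqP-> //|kn].
  by have [-> ->] := e k kn; apply: w1.
- move=> k; rewrite ltnS ltnS leq_eqVlt => /orP[/eqP->|kn].
    by have [-> ->] := e n (leqnn n).
  have [-> ->] := e k (ltnW kn); have [-> ->] := e k.+1 kn.
  exact: w2.
move=> k l; rewrite ltnS leq_eqVlt [(l < _)%N]ltnS [(l <= _)%N]leq_eqVlt.
move=> /orP[/eqP->|kn] /orP[/eqP->|ln] //.
- by have [_ ->] := e l ln => /esym/(fresh l ln).
- by have [_ ->] := e k kn => /(fresh k kn).
by have [_ ->] := e k kn; have [_ ->] := e l ln; apply: w3.
Qed.

(** * The invariant and the potential, and how one step changes them *)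

Section Step.
Variables (C T : nat) (E : nat -> R) (y dd z0 : nat -> nat -> R).

(* In the second case the column was exact when all its entries but that of row
   [c] had become integral, and [v] is the value of the latter at that time. *)
Definition column_ok (X : nat -> nat -> R) t :=
  \sum_(c < C) E c * X c t = \sum_(c < C) E c * y c t \/
  exists c v, [/\ (c < C)%N, 0 <= v <= 1,
    forall c', (c' < C)%N -> c' != c -> frac (X c' t) = false
    & \sum_(c < C) E c * X c t - \sum_(c < C) E c * y c t =
      E c * (X c t - v)].

(** [dd] is the fixed integral part and [z0] the initial z. The third clause concerns the integral
    prefix sums of [y], where floor and ceiling coincide and leave no room to move. *)
Definition inv (X Z : nat -> nat -> R) :=
  [/\ forall c t, (c < C)%N -> (t <= T)%N ->
        0 <= X c t <= 1 /\ 0 <= Z c t <= 1,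
      forall c t, (c < C)%N -> (t <= T)%N ->
        X c t = dd c t + (if (t < T)%N then Z c t.+1 else 0) - Z c t,
      forall c t, (c < C)%N -> (t <= T)%N -> z0 c t = 0 -> Z c t = 0
    & forall t, (t < T)%N -> column_ok X t].

(* The step is [1 / mu]. If the direction is zero then so is [mu], and division
   by zero makes the step harmless. Entries at a bound do not move, and contribute
   [0 / 0 = 0]. *)
Definition max_ratio (X Z W DZ : nat -> nat -> R) mu :=
  [/\ 0 <= mu,
      forall c t, (c < C)%N -> (t <= T)%N ->
        [/\ W c t / (1 - X c t) <= mu, - W c t / X c t <= mu,
            DZ c t / (1 - Z c t) <= mu & - DZ c t / Z c t <= mu]
    & mu = 0 \/ exists c t, [/\ (c < C)%N, (t <= T)%N &
        (mu = W c t / (1 - X c t) \/ mu = - W c t / X c t) \/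
        (mu = DZ c t / (1 - Z c t) \/ mu = - DZ c t / Z c t)]].

(** The potential that bounds the number of steps. *)
Definition nfrac (X Z : nat -> nat -> R) : nat :=
  (\sum_(c < C) \sum_(t < T.+1) (frac (X c t) + frac (Z c t)))%N.

Lemma ltn_sum_ord n (f g : nat -> nat) i : (i < n)%N ->
  (forall j, (j < n)%N -> f j <= g j)%N -> (f i < g i)%N ->
  (\sum_(j < n) f j < \sum_(j < n) g j)%N.
Proof.
move=> ni le lt; rewrite (bigD1 (Ordinal ni)) //=.
rewrite [X in (_ < X)%N](bigD1 (Ordinal ni)) //=.
by rewrite -addSn leq_add // leq_sum // => j _; apply: le.
Qed.

(** The memory is specified only on the grid [c < C], [t <= T]. This lemma and the next two with
    [_ext] in their name therefore transfer facts between functions that agree there. *)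
Lemma inv_ext X Z X1 Z1 :
  (forall c t, (c < C)%N -> (t <= T)%N -> X1 c t = X c t /\ Z1 c t = Z c t) ->
  inv X Z -> inv X1 Z1.
Proof.
move=> e [bnd lnk hz col]; split.
- by move=> c t cC tT; have [-> ->] := e _ _ cC tT; apply: bnd.
- move=> c t cC tT; have [-> ->] := e _ _ cC tT; rewrite lnk //.
  by case: ltnP => // tT'; have [_ ->] := e _ _ cC tT'.
- by move=> c t cC tT; have [_ ->] := e _ _ cC tT; apply: hz.
move=> t tT; have eX c : (c < C)%N -> X1 c t = X c t.
  by move=> cC; have [] := e _ _ cC (ltnW tT).
have eS : \sum_(c < C) E c * X1 c t = \sum_(c < C) E c * X c t.
  by apply: eq_bigr => c _; rewrite eX.
case: (col _ tT) => [ex|[c [v [cC v01 oth near]]]]; [left|right].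
  by rewrite eS.
exists c, v; split=> //; last by rewrite eS eX.
by move=> c' cC' ne; rewrite eX // oth.
Qed.

Lemma nfrac_ext X Z X1 Z1 :
  (forall c t, (c < C)%N -> (t <= T)%N -> X1 c t = X c t /\ Z1 c t = Z c t) ->
  nfrac X1 Z1 = nfrac X Z.
Proof.
move=> e; apply: eq_bigr => c _; apply: eq_bigr => t _.
by have [|-> ->] := e c t (ltn_ord c); rewrite // -ltnS.
Qed.

Lemma max_ratio_ext X Z W DZ W1 DZ1 mu :
  (forall c t, (c < C)%N -> (t <= T)%N -> W1 c t = W c t /\ DZ1 c t = DZ c t) ->
  max_ratio X Z W DZ mu -> max_ratio X Z W1 DZ1 mu.
Proof.
move=> e [h1 h2 h3]; split=> // [c t cC tT|].
  by have [-> ->] := e _ _ cC tT; apply: h2.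
case: h3 => [|[c [t [cC tT h]]]]; [by left|right; exists c, t].
by have [-> ->] := e _ _ cC tT.
Qed.

Lemma nfrac_le X Z : (nfrac X Z <= 2 * (C * T.+1))%N.
Proof.
apply: (@leq_trans (\sum_(c < C) \sum_(t < T.+1) 2)).
  by apply: leq_sum => c _; apply: leq_sum => t _; do 2 case: (frac _).
by rewrite !sum_nat_const !card_ord; lia.
Qed.

Lemma nfrac0 X Z c t : nfrac X Z = 0%N -> (c < C)%N -> (t <= T)%N ->
  frac (X c t) = false.
Proof.
move=> n0 cC tT; have := n0; rewrite /nfrac => /eqP.
rewrite sum_nat_eq0 => /forallP/(_ (Ordinal cC))/=.
rewrite sum_nat_eq0 => /forallP/(_ (Ordinal (tT : (t < T.+1)%N)))/=.
by case: (frac (X c t)).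
Qed.

Section Move.
Variables (X Z W DZ : nat -> nat -> R) (mu : R) (prot : nat -> bool).
Hypothesis dir : direction C T E X Z prot W DZ.
Hypothesis DZE : forall c t, (c < C)%N -> (t <= T)%N -> DZ c t = \sum_(u < t) W c u.
Hypothesis ratio : max_ratio X Z W DZ mu.
Hypothesis unprot : forall t, (t < T)%N -> ~~ prot t ->
  forall c c', (c < C)%N -> (c' < C)%N -> frac (X c t) -> frac (X c' t) -> c = c'.

Let X' c t := X c t + W c t / mu.
Let Z' c t := Z c t + DZ c t / mu.

(** The bounds come from [mu], and the link between x and z is linear. An exact column stays exact
    while protected. Once it is unprotected at most one of its entries can move, and the value of
    that entry before the step becomes the [v] of [column_ok]; later steps keep this [v]. *)
Lemma inv_move : inv X Z -> inv X' Z'.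
Proof.
have [dX dZ d0 dE] := dir; have [mu0 mle _] := ratio.
case=> bnd lnk hz col; split.
- move=> c t cC tT; have [bX bZ] := bnd _ _ cC tT; have [m1 m2 m3 m4] := mle _ _ cC tT.
  by split; apply: move_bound => //; [apply: dX|apply: dZ].
- move=> c t cC tT; rewrite /X' /Z' lnk // (DZE cC tT); case: ltnP => tT'.
    by rewrite (DZE cC tT') big_ord_recr /=; ring.
  (* In the virtual column the zero row sum makes the entry move by minus the prefix sum in front of
     it. *)
  have e := d0 _ cC; rewrite big_ord_recr /= in e.
  have -> : t = T by lia.
  by rewrite (eqP (_ : W c T == - \sum_(u < T) W c u)); [ring|rewrite -addr_eq0 addrC e].
- move=> c t cC tT /(hz _ _ cC tT) z; rewrite /Z' z add0r.
  have [->|/(dZ _ _ cC tT)] := eqVneq (DZ c t) 0; first by rewrite mul0r.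
  by rewrite /frac z ltxx.
move=> t tT; have tT' := ltnW tT.
have sumX : \sum_(c < C) E c * X' c t =
    \sum_(c < C) E c * X c t + (\sum_(c < C) E c * W c t) / mu.
  by rewrite mulr_suml -big_split; apply: eq_bigr => c _; rewrite /X' mulrDr mulrA.
have still c' : (c' < C)%N -> frac (X c' t) = false -> W c' t = 0.
  move=> cC fF; have [//|/(dX _ _ cC tT')] := eqVneq (W c' t) 0.
  by rewrite fF.
have only c : (c < C)%N ->
    (forall c', (c' < C)%N -> c' != c -> frac (X c' t) = false) ->
    \sum_(c < C) E c * W c t = E c * W c t /\
    (forall c', (c' < C)%N -> c' != c -> frac (X' c' t) = false).
  move=> cC oth; split=> [|c' cC' ne].
    rewrite (bigD1 (Ordinal cC)) //= big1 ?addr0 // => c'.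
    by rewrite -val_eqE /= => ne; rewrite still ?mulr0 // oth.
  by rewrite /X' still ?mul0r ?addr0 ?oth.
case: (col _ tT) => [ex|[c [v [cC v01 oth near]]]]; last first.
  have [sW oth'] := only _ cC oth; right; exists c, v; split=> //.
  by rewrite sumX addrAC near sW /X'; ring.
case: (boolP (prot t)) => pt; first by left; rewrite sumX dE // mul0r addr0.
case: (boolP [exists c : 'I_C, frac (X c t)]) => [/existsP[c fc]|].
  have [||sW oth'] := @only c => //.
    move=> c' cC' ne; apply: contra_neqF ne => fc'; exact: (unprot tT pt).
  right; exists c, (X c t); split=> //; first by have [] := bnd c t (ltn_ord c) tT'.
  by rewrite sumX ex sW /X'; ring.
move/existsPn => nf; left; rewrite sumX ex [X in X / mu]big1 ?mul0r ?addr0 // => c _.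
by rewrite still ?mulr0 //; apply/negbTE/nf.
Qed.

(** Only fractional values move, so none becomes fractional. As some entry moves, [mu] is positive,
    and the value at which [mu] is attained becomes integral. *)
Lemma nfrac_move :
  (exists c t, [/\ (c < C)%N, (t <= T)%N & W c t != 0]) ->
  (nfrac X' Z' < nfrac X Z)%N.
Proof.
have [dX dZ _ _] := dir; have [_ mle att] := ratio.
move=> [c1 [t1 [cC1 tT1 w1]]].
have mp : 0 < mu.
  have [m1 m2 _ _] := mle _ _ cC1 tT1.
  exact: (move_pos (dX _ _ cC1 tT1 w1) w1 m1 m2).
case: att => [m0|[c [t [cC tT att]]]]; first by rewrite m0 ltxx in mp.
have m0 : mu != 0 by rewrite gt_eqF.
have leX c' t' : (c' < C)%N -> (t' <= T)%N -> (frac (X' c' t') <= frac (X c' t'))%N.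
  move=> cC' tT'; case: (boolP (frac (X' c' t'))) => // h.
  by rewrite (move_frac _ h) //; apply: dX.
have leZ c' t' : (c' < C)%N -> (t' <= T)%N -> (frac (Z' c' t') <= frac (Z c' t'))%N.
  move=> cC' tT'; case: (boolP (frac (Z' c' t'))) => // h.
  by rewrite (move_frac _ h) //; apply: dZ.
apply: (@ltn_sum_ord _ (fun c => \sum_(t < T.+1) (frac (X' c t) + frac (Z' c t)))%N
  (fun c => \sum_(t < T.+1) (frac (X c t) + frac (Z c t)))%N c) => //.
  by move=> c' cC'; apply: leq_sum => t' _; apply: leq_add; [apply: leX|apply: leZ];
     rewrite // -ltnS; apply: ltn_ord.
apply: (@ltn_sum_ord _ (fun t => frac (X' c t) + frac (Z' c t))%N
  (fun t => frac (X c t) + frac (Z c t))%N t) => //.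
  by move=> t' tT'; apply: leq_add; [apply: leX|apply: leZ].
case: att => att.
  have [|-> /negPf nf] := @move_tight (X c t) (W c t) mu _ m0 att; first exact: dX.
  by rewrite /X' nf addSn ltnS; apply: leZ.
have [|-> /negPf nf] := @move_tight (Z c t) (DZ c t) mu _ m0 att; first exact: dZ.
by rewrite /Z' nf addn0 addn1 ltnS; apply: leX.
Qed.

End Move.
End Step.
End Rounding.

Local Open Scope nat_scope.

(** * The program *)

(* Reals: 0 = E, 1 = y, 2 = output, 3 = x, 4 = z, 5 and 6 = direction of x and z,
   7 = mu, 9 = accumulator.
   Naturals: 0 = (C, T), 2 = row offsets c * T, 4 to 8 = loop counters,
   9 and 10 = for each column, 1 + a row with a fractional entry, and 1 + another
   such row (0 if there is none; in array 10 also for the virtual column, so that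
   the protected columns are those with a nonzero cell), 11 = partners,
   12 = last fractional entry of the row, 13 = "the walk goes on",
   15 = temporary, 16 and 17 = rows and columns of the walk, 18 = 1 + position
   of a column in the walk, 20 and 21 = bounds of the closed part of the walk.
   Arrays 3 to 6 and 11 have rows of length T + 1, arrays 1 and 2 of length T. *)
Notation scal a := (NGet a (NConst 0)).
Notation cell c t := (NAdd (NAdd (NGet 2 c) c) t).
Notation rowcell c t := (NAdd (NGet 2 c) t).
Notation bfrac e := (BAnd (BNot (RLe e (RConst 0))) (BNot (RLe (RConst 1) e))).
Notation forC := (PFor 6 0 0).
Notation forT := (PFor 7 1 0).
Notation forS := (PFor 7 1 1).
Notation vc := (scal 6).
Notation vt := (scal 7).
Notation vk := (scal 8).
Notation Tm := (NGet 0 (NConst 1)).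
Infix ";;" := PSeq (at level 60, right associativity).

(** Naturals cannot be multiplied, so the offsets [c * T] are tabulated by repeated addition. *)
Definition p_base : prog :=
  forC (PN 2 (NAdd vc (NConst 1)) (NAdd (NGet 2 vc) Tm)).

(** In the absence of a floor, the accumulator is kept in [[0, 1)] by subtracting 1 as soon as it
    reaches 1. The virtual entry completes the row sum to an integer. *)
Definition p_init : prog :=
  forC (PR 9 (NConst 0) (RConst 0) ;;
        forT (PR 4 (cell vc vt) (RGet 9 (NConst 0)) ;;
              PR 3 (cell vc vt) (RGet 1 (rowcell vc vt)) ;;
              PR 9 (NConst 0)
                 (RAdd (RGet 9 (NConst 0)) (RGet 1 (rowcell vc vt))) ;;
              PIf (RLe (RConst 1) (RGet 9 (NConst 0)))
                (PR 9 (NConst 0) (RSub (RGet 9 (NConst 0)) (RConst 1)))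
                PSkip) ;;
        PR 4 (cell vc Tm) (RGet 9 (NConst 0)) ;;
        PR 3 (cell vc Tm) (RSub (RConst 1) (RGet 9 (NConst 0)))).

Definition p_clear : prog :=
  forS (PN 9 vt (NConst 0) ;; PN 10 vt (NConst 0) ;; PN 18 vt (NConst 0)) ;;
  forC (forS (PR 5 (cell vc vt) (RConst 0))) ;;
  PR 7 (NConst 0) (RConst 0) ;; PN 13 (NConst 0) (NConst 0) ;;
  PN 21 (NConst 0) (NConst 0) ;; PN 20 (NConst 0) (NConst 0).

Definition p_cols : prog :=
  forC (forS (PIf (bfrac (RGet 3 (cell vc vt)))
    (PIf (NLe (NGet 9 vt) (NConst 0))
       (PN 9 vt (NAdd vc (NConst 1)))
       (PN 10 vt (NAdd vc (NConst 1))))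
    PSkip)) ;;
  PN 10 Tm (NConst 0).

(** A fractional entry preceded by a fractional z is linked, in both directions, with the last
    fractional entry before it, since the z's between the two are all fractional. A later link may
    replace an earlier one. Links never cross rows because z is 0 at the start of a row. *)
Definition p_partner : prog :=
  forC (forS (PIf (bfrac (RGet 3 (cell vc vt)))
    (PIf (bfrac (RGet 4 (cell vc vt)))
       (PN 11 (cell vc vt) (scal 12) ;; PN 11 (cell vc (scal 12)) vt)
       PSkip ;;
     PN 12 (NConst 0) vt)
    PSkip)).

(** The first fractional entry is taken provisionally; afterwards only entries in unprotected
    columns replace it. *)
Definition p_start : prog :=
  forC (forS (PIf (BAnd (bfrac (RGet 3 (cell vc vt)))
                   (BNot (BAnd (NLe (NConst 1) (scal 13))
                               (NLe (NConst 1) (NGet 10 vt)))))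
    (PN 13 (NConst 0) (NConst 1) ;;
     PN 16 (NConst 0) vc ;; PN 17 (NConst 0) vt)
    PSkip)).

(** Marking columns with their position in the walk makes the test for a revisit take constant time.
    Of the two rows recorded for a protected column one differs from the row of arrival, and the
    walk leaves through it. *)
Definition p_walk : prog :=
  PFor 8 1 1 (PIf (NLe (NConst 1) (scal 13))
    (PN 18 (NGet 17 vk) (NAdd vk (NConst 1)) ;;
     PN 21 (NConst 0) (NAdd vk (NConst 1)) ;;
     PN 15 (NConst 0) (NGet 11 (cell (NGet 16 vk) (NGet 17 vk))) ;;
     PIf (NLe (NGet 10 (scal 15)) (NConst 0))
       (PN 13 (NConst 0) (NConst 0))
       (PIf (NLe (NConst 1) (NGet 18 (scal 15)))
          (PN 13 (NConst 0) (NConst 0) ;;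
           PN 20 (NConst 0) (NSub (NGet 18 (scal 15)) (NConst 1)))
          (PN 17 (NAdd vk (NConst 1)) (scal 15) ;;
           PIf (BAnd (NLe (NGet 9 (scal 15)) (NAdd (NGet 16 vk) (NConst 1)))
                     (NLe (NAdd (NGet 16 vk) (NConst 1)) (NGet 9 (scal 15))))
             (PN 16 (NAdd vk (NConst 1)) (NSub (NGet 10 (scal 15)) (NConst 1)))
             (PN 16 (NAdd vk (NConst 1)) (NSub (NGet 9 (scal 15)) (NConst 1))))))
    PSkip).

Definition p_flow : prog :=
  PFor 8 1 1 (PIf (BAnd (NLe (scal 20) vk) (NLe (NAdd vk (NConst 1)) (scal 21)))
    (PN 15 (NConst 0) (cell (NGet 16 vk) (NGet 17 vk)) ;;
     PR 5 (scal 15)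
       (RAdd (RGet 5 (scal 15)) (RDiv (RConst 1) (RGet 0 (NGet 16 vk)))) ;;
     PN 15 (NConst 0) (cell (NGet 16 vk) (NGet 11 (scal 15))) ;;
     PR 5 (scal 15)
       (RSub (RGet 5 (scal 15)) (RDiv (RConst 1) (RGet 0 (NGet 16 vk)))))
    PSkip).

Definition p_prefix : prog :=
  forC (PR 9 (NConst 0) (RConst 0) ;;
        forS (PR 6 (cell vc vt) (RGet 9 (NConst 0)) ;;
              PR 9 (NConst 0)
                 (RAdd (RGet 9 (NConst 0)) (RGet 5 (cell vc vt))))).

Definition p_max (e : rexp) : prog :=
  PIf (RLe (RGet 7 (NConst 0)) e) (PR 7 (NConst 0) e) PSkip.

Definition p_max2 (v d : rexp) : prog :=
  p_max (RDiv d (RSub (RConst 1) v)) ;; p_max (RDiv (RSub (RConst 0) d) v).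

Definition p_ratio : prog :=
  forC (forS
    (p_max2 (RGet 3 (cell vc vt)) (RGet 5 (cell vc vt)) ;;
     p_max2 (RGet 4 (cell vc vt)) (RGet 6 (cell vc vt)))).

Definition p_move : prog :=
  forC (forS
    (PR 3 (cell vc vt) (RAdd (RGet 3 (cell vc vt))
        (RDiv (RGet 5 (cell vc vt)) (RGet 7 (NConst 0)))) ;;
     PR 4 (cell vc vt) (RAdd (RGet 4 (cell vc vt))
        (RDiv (RGet 6 (cell vc vt)) (RGet 7 (NConst 0)))))).

Definition p_iter : prog :=
  p_clear ;; p_cols ;; p_partner ;; p_start ;; p_walk ;; p_flow ;;
  p_prefix ;; p_ratio ;; p_move.

Definition p_out : prog :=
  forC (forT (PR 2 (rowcell vc vt) (RGet 3 (cell vc vt)))).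

(** Two iterations in each of the [C * (T + 1)] rounds make up the maximal value of the
    potential. *)
Definition p_main : prog :=
  p_base ;; p_init ;; PFor 4 0 0 (PFor 5 1 1 (p_iter ;; p_iter)) ;; p_out.

(** The outer loops contribute one factor [C] and one factor [T]; so does an iteration, none of
    whose phases nests more than one loop over rows and one over columns. *)
Lemma main_wf : [/\ wf p_main, degC p_main = 2 & degT p_main = 2].
Proof. by []. Qed.

(** * Addresses of cells and row-by-row scans *)

Section Layout.
Variables (R : realType) (C T : nat).
Implicit Types s : state R.

(** The order in which a double loop visits the grid; loop invariants speak about the entries before
    the current one. *)
Definition ltlex c' t' c t := ((c' < c) || ((c' == c) && (t' < t))).

Lemma ltlexS c' t' c t :
  ltlex c' t' c t.+1 = ((c' == c) && (t' == t)) || ltlex c' t' c t.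
Proof. by rewrite /ltlex; lia. Qed.

Lemma ltlex_row c' t' c : (t' <= T) ->
  ltlex c' t' c T.+1 = ltlex c' t' c.+1 0.
Proof. by rewrite /ltlex; lia. Qed.

Lemma ltlex_rowT c' t' c : (t' < T) ->
  ltlex c' t' c T = ltlex c' t' c.+1 0.
Proof. by rewrite /ltlex; lia. Qed.

Lemma ltlex0 c' t' : ltlex c' t' 0 0 = false.
Proof. by rewrite /ltlex; lia. Qed.

Lemma ltlex_end c' t' : (c' < C) -> ltlex c' t' C 0.
Proof. by rewrite /ltlex => ->. Qed.

Lemma ltlex_irr c t : ltlex c t c t = false.
Proof. by rewrite /ltlex; lia. Qed.

Lemma cell_inj c t c' t' : (t <= T) -> (t' <= T) ->
  (c * T + c + t == c' * T + c' + t') = (c == c') && (t == t').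
Proof.
move=> tT tT'; apply/eqP/andP => [e|[/eqP-> /eqP->] //].
have h a b : (b <= T) -> ((a * T + a + b) %/ T.+1 = a).
  by move=> bT; rewrite -mulnSr divnMDl // divn_small ?addn0.
have ec : c = c' by rewrite -(h c t) // -(h c' t') // e.
by split; apply/eqP => //; lia.
Qed.

Lemma rowcell_inj c t c' t' : (t < T) -> (t' < T) ->
  (c * T + t == c' * T + t') = (c == c') && (t == t').
Proof.
move=> tT tT'; apply/eqP/andP => [e|[/eqP-> /eqP->] //].
have h a b : (b < T) -> ((a * T + b) %/ T = a).
  by move=> bT; rewrite divnMDl ?divn_small ?addn0 //; lia.
have ec : c = c' by rewrite -(h c t) // -(h c' t') // e.
by split; apply/eqP => //; lia.
Qed.

Definition std s :=
  [/\ nmem s 0 0 = C, nmem s 0 1 = T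
    & forall c, (c < C) -> nmem s 2 c = (c * T)].

Lemma std_run p s : 0 \notin nwrites p -> 2 \notin nwrites p ->
  std s -> std (run p s).
Proof. by move=> h0 h2 [sC sT sB]; rewrite /std !run_nmem. Qed.

(** Two nested uses of [run_for]. The invariant must survive changes of the two counters and pass
    from the end of a row to the start of the next one. *)
Lemma run_for2 (J : nat -> nat -> state R -> Prop) (p : prog) s :
  std s -> [&& 6 \notin nwrites p, 7 \notin nwrites p, 0 \notin nwrites p
             & 2 \notin nwrites p] ->
  (forall c t n s, J c t s -> J c t (setn 6 n s)) ->
  (forall c t n s, J c t s -> J c t (setn 7 n s)) ->
  J 0 0 s ->
  (forall c s, J c T.+1 s -> J c.+1 0 s) ->
  (forall c t s', (c < C) -> (t <= T) -> std s' ->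
     nmem s' 6 0 = c -> nmem s' 7 0 = t ->
     (forall a, a \notin [:: 6, 7 & nwrites p] -> nmem s' a = nmem s a) ->
     (forall a, a \notin rwrites p -> rmem s' a = rmem s a) ->
     J c t s' -> J c t.+1 (run p s')) ->
  J C 0 (run (forC (forS p)) s).
Proof.
move=> ss /and4P[p6 p7 p0 p2] J6 J7 J0 Jrow Jstep; have [sC sT sB] := ss.
have := @run_for R (fun c s => J c 0 s) 6 0 0 (forS p) s.
rewrite addn0 sC; apply=> //.
- exact: (J6).
move=> c s1 cC s1c s1n s1r J1; apply: (J6) => //; apply: Jrow.
have ss1 : std s1.
  by split=> [||c' cC']; rewrite s1n ?sB // !inE (negPf p0, negPf p2).
have [s1C s1T s1B] := ss1.
have := @run_for R (J c) 7 1 1 p s1.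
rewrite addn1 s1T; apply=> //.
- exact: (J7).
move=> t s2 tT s2t s2n s2r J2; apply: (J7) => //.
have ss2 : std s2.
  by split=> [||c' cC']; rewrite s2n ?s1B // !inE (negPf p0, negPf p2).
apply: Jstep => //.
- by rewrite s2n // !inE.
- move=> a; rewrite !inE => /norP[a6 /norP[a7 ap]].
  by rewrite s2n ?s1n // !inE (negPf a6, negPf a7) (negPf a7, negPf ap).
- by move=> a ap; rewrite s2r ?s1r.
Qed.

End Layout.

Local Open Scope ring_scope.

(** * Specification of the phases *)

Section Phases.
Variables (R : realType) (C T : nat).
Implicit Types s : state R.

Definition rcell s a c t : R := rmem s a (c * T + c + t)%N.
Arguments rcell _ _%_nat_scope _ _.
Definition ncell s a c t : nat := nmem s a (c * T + c + t)%N.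

Arguments ncell _ _%_nat_scope _ _.

Lemma upd_cell (V : Type) (m : nat -> nat -> V) a b c t c' t' v :
  (t <= T)%N -> (t' <= T)%N ->
  upd m a (c * T + c + t) v b (c' * T + c' + t') =
  if (b == a) && ((c' == c) && (t' == t)) then v
  else m b (c' * T + c' + t')%N.
Proof. by move=> tT tT'; rewrite /upd cell_inj. Qed.

Lemma beval_frac s e : beval s (bfrac e) = frac (reval s e).
Proof. by rewrite /= /frac -!ltNge. Qed.

Lemma run_seq p q s : run (p ;; q) s = run q (run p s).
Proof. by []. Qed.

Lemma beval_and s b1 b2 : beval s (BAnd b1 b2) = beval s b1 && beval s b2.
Proof. by []. Qed.

Lemma run_if b p q s :
  run (PIf b p q) s = if beval s b then run p s else run q s.
Proof. by []. Qed.

Let X s := rcell s 3.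
Let Z s := rcell s 4.
Let W s := rcell s 5.

Lemma run_clear s : std C T s ->
  let s' := run p_clear s in
  [/\ forall t, (t <= T)%N ->
        [/\ nmem s' 9 t = 0, nmem s' 10 t = 0 & nmem s' 18 t = 0]%N,
      forall c t, (c < C)%N -> (t <= T)%N -> W s' c t = 0,
      rmem s' 7 0 = 0
    & [/\ nmem s' 13 0 = 0, nmem s' 21 0 = 0 & nmem s' 20 0 = 0]%N].
Proof.
move=> ss; rewrite /p_clear.
rewrite 2!run_seq; set pt := forS (PSeq _ _); set pw := PFor 6 0 0 _.
pose I j s := forall t, (t < j)%N ->
        [/\ nmem s 9 t = 0, nmem s 10 t = 0 & nmem s 18 t = 0]%N.
have H1 : I T.+1 (run pt s).
  have [_ sT _] := ss; rewrite -addn1 -sT /pt; set p := (X in PFor _ _ _ X).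
  apply: (@run_for R I 7%N 1%N 1%N p s) => // j s' _ e _ _ h t.
  rewrite ltnS leq_eqVlt /= => ht.
  rewrite /= /upd /= e; case: eqP ht => // _ /= /h[*].
  by split.
have ss1 : std C T (run pt s) by apply: std_run.
move: (run pt s) H1 ss1 => s1 H1 ss1.
have H2 : forall c t, (c < C)%N -> (t <= T)%N -> W (run pw s1) c t = 0.
  pose J c t s := forall c' t', (t' <= T)%N -> ltlex c' t' c t -> W s c' t' = 0.
  have : J C 0%N (run pw s1).
    apply: (run_for2 ss1) => //.
    - by move=> c' t' _; rewrite ltlex0.
    - by move=> c s2 h c' t' tT; rewrite -(ltlex_row _ _ tT); apply: h.
    move=> c t s2 cC tT [_ _ sB] sc st _ _ h c' t' tT' /=.
    rewrite ltlexS /W /rcell /= sc st sB // upd_cell //=.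
    by case: ifP => //= _ /(h _ _ tT').
  by move=> h c t cC tT; apply: h => //; apply: ltlex_end.
have H1' : forall t, (t <= T)%N ->
   [/\ nmem (run pw s1) 9 t = 0, nmem (run pw s1) 10 t = 0
     & nmem (run pw s1) 18 t = 0]%N.
  by move=> t tT; rewrite !run_nmem //; apply: H1.
move: (run pw s1) H1' H2 => s2 H1' H2.
by split.
Qed.

Definition cols_spec s (A B : nat -> nat) :=
  forall t, (t <= T)%N ->
  [/\ A t = 0%N -> forall c, (c < C)%N -> frac (X s c t) = false,
      A t != 0%N -> ((A t).-1 < C)%N && frac (X s (A t).-1 t),
      B t != 0%N -> [/\ A t != 0%N, ((B t).-1 < C)%N, (t < T)%N,
                       frac (X s (B t).-1 t) & A t != B t]
    & B t = 0%N -> (t < T)%N -> forall c, (c < C)%N -> frac (X s c t) -> c.+1 = A t].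

Lemma run_cols s : std C T s ->
  (forall t, (t <= T)%N -> nmem s 9 t = 0%N /\ nmem s 10 t = 0%N) ->
  let s' := run p_cols s in cols_spec s (nmem s' 9) (nmem s' 10).
Proof.
move=> ss z; rewrite /p_cols; set p := PFor 6 0 0 _.
(* The row recorded by [A] is required to have been visited already, so a fractional entry met later
   in the column lies in a different row. This gives [A != B]. *)
pose Q c t t' A B :=
  [/\ A = 0%N -> forall c', (c' < C)%N -> ltlex c' t' c t -> frac (X s c' t') = false,
      A != 0%N -> [&& (A.-1 < C)%N, ltlex A.-1 t' c t & frac (X s A.-1 t')],
      B != 0%N -> [/\ A != 0%N, (B.-1 < C)%N, frac (X s B.-1 t') & A != B]
    & B = 0%N -> forall c', (c' < C)%N -> ltlex c' t' c t -> frac (X s c' t') ->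
        c'.+1 = A].
pose J c t s1 := forall t', (t' <= T)%N -> Q c t t' (nmem s1 9 t') (nmem s1 10 t').
have H : J C 0%N (run p s).
  apply: (run_for2 ss) => //.
  - move=> t' tT; have [-> ->] := z _ tT; split=> // _ c' _; by rewrite ltlex0.
  - move=> c s1 h t' tT; have [h1 h2 h3 h4] := h _ tT.
    by split=> //; rewrite -?(ltlex_row _ _ tT) // => a c' cC;
       rewrite -(ltlex_row _ _ tT); [apply: h1|apply: h4].
  move=> c t s1 cC tT [_ _ sB] sc st _ sr h.
  have eX : reval s1 (RGet 3 (cell vc vt)) = X s c t.
    by rewrite /= sc st sB // sr.
  have keep t' A B : t' != t -> Q c t t' A B -> Q c t.+1 t' A B.
    move=> ne [h1 h2 h3 h4]; split=> //.
    - by move=> a c' cC'; rewrite ltlexS (negPf ne) andbF; apply: h1.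
    - by rewrite ltlexS (negPf ne) andbF.
    - by move=> a c' cC'; rewrite ltlexS (negPf ne) andbF; apply: h4.
  rewrite run_if beval_frac eX; case: ifP => fX t' tT'; have := h _ tT'; last first.
    have [->|ne] := eqVneq t' t; last exact: keep.
    move=> [h1 h2 h3 h4]; split=> //.
    - by move=> a c' cC'; rewrite ltlexS; case/orP=> [/andP[/eqP-> _] //|]; exact: h1.
    - by move=> /h2/and3P[-> hl ->]; rewrite ltlexS hl orbT.
    - move=> a c' cC'; rewrite ltlexS; case/orP=> [/andP[/eqP-> _]|]; last exact: h4.
      by rewrite fX.
  rewrite run_if /= leqn0 st sc; case: eqP => A0; rewrite /= /upd /= addn1.
    have [->|ne] := eqVneq t' t; last exact: keep.
    move=> [h1 h2 h3 h4]; split=> //=.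
    - by move=> _; rewrite cC fX ltlexS !eqxx.
    - by move=> /h3[]; rewrite A0.
    - move=> a c' cC'; rewrite ltlexS; case/orP=> [/andP[/eqP-> _]//|l f].
      by rewrite (h1 A0) in f.
  have [->|ne] := eqVneq t' t; last exact: keep.
  move=> [h1 h2 h3 h4].
  have An0 : nmem s1 9 t != 0%N by apply/eqP.
  have /and3P[AC Al Af] := h2 An0; split=> //=.
  - by rewrite AC Af ltlexS Al orbT.
  - move=> _; split=> //; apply/eqP => Ac; move: Al.
    by rewrite Ac /= ltlex_irr.
set s' := run _ s => t tT; have [h1 h2 h3 h4] := H _ tT.
have -> : nmem s' 9 t = nmem (run p s) 9 t by [].
have -> : nmem s' 10 t = if (t < T)%N then nmem (run p s) 10 t else 0%N.
  have [_ sT _] : std C T (run p s) by apply: std_run.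
  rewrite /s' /= /upd /= sT; case: eqP => [->|]; rewrite ?ltnn //.
  by case: ltnP => //; lia.
split.
- by move=> a c cC; apply: h1 => //; apply: ltlex_end.
- by move=> /h2/and3P[-> _ ->].
- by case: ltnP => // tT' /h3[*]; split.
- by case: ltnP => // tT' b _ c cC; apply: h4 => //; apply: ltlex_end.
Qed.
Lemma run_partner s : std C T s ->
  let zfr c t := (t <= T)%N && frac (Z s c t) in
  (forall c, (c < C)%N -> frac (Z s c 0) = false) ->
  (forall c t, (c < C)%N -> (t <= T)%N ->
     (frac (X s c t) -> zfr c t || zfr c t.+1) /\
     (frac (X s c t) = false -> zfr c t = zfr c t.+1)) ->
  let s' := run p_partner s in
  forall c t, (c < C)%N -> (t <= T)%N -> frac (X s c t) ->
    partner_ok T (X s) (Z s) (ncell s' 11) c t.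
Proof.
move=> ss zfr z0 link s'.
pose pok c t p := [/\ (p <= T)%N, p != t, frac (X s c p)
    & forall u, (minn t p < u <= maxn t p)%N -> frac (Z s c u)].
(* Only the last fractional entry [q] of the current row may still lack a partner, and only while z
   has been fractional ever since. As [zfr] is false after the virtual column, no entry is left
   waiting at the end of a row. *)
pose Q c t (q : nat) (P : nat -> nat -> nat) :=
  (forall c' t', (c' < C)%N -> (t' <= T)%N -> ltlex c' t' c t ->
    frac (X s c' t') -> pok c' t' (P c' t') \/ [/\ c' = c, t' = q & zfr c t]) /\
  ((c < C)%N -> zfr c t -> [/\ (q < t)%N, frac (X s c q)
    & forall u, (q < u <= t)%N -> frac (Z s c u)]).
pose J c t s1 := Q c t (nmem s1 12 0) (ncell s1 11).
have : J C 0%N s'.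
  apply: (run_for2 ss) => //.
  - by split=> [c' t' _ _|c0]; [rewrite ltlex0|rewrite /zfr z0].
  - move=> c s1 [h1 h2]; split=> [c' t' cC' tT' l f|cC]; last by rewrite /zfr z0.
    left; rewrite -(ltlex_row _ _ tT') in l.
    by case: (h1 c' t' cC' tT' l f) => // -[_ _]; rewrite /zfr ltnn.
  move=> c t s1 cC tT [_ _ sB] sc st _ sr [h1 h2].
  have eX : reval s1 (RGet 3 (cell vc vt)) = X s c t.
    by rewrite /= sc st sB // sr.
  have eZ : reval s1 (RGet 4 (cell vc vt)) = Z s c t.
    by rewrite /= sc st sB // sr.
  have [l1 l2] := link _ _ cC tT.
  have zt : frac (Z s c t) = zfr c t by rewrite /zfr tT.
  rewrite run_if beval_frac eX; case: ifP => fX; last first.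
    split=> [c' t' cC' tT'|_]; last first.
      rewrite -l2 // => hz; have [q1 q2 q3] := h2 cC hz.
      split=> // [|u]; first exact: leqW.
      move=> /andP[u1]; rewrite leq_eqVlt => /orP[/eqP->|u2].
        by move: hz; rewrite l2 // => /andP[].
      by apply: q3; rewrite u1.
    rewrite ltlexS; case/orP=> [/andP[/eqP-> /eqP->]|l f]; first by rewrite fX.
    by rewrite -l2 //; apply: h1.
  rewrite run_seq run_if beval_frac eZ zt; case: ifP => hz; last first.
    split=> [c' t' cC' tT'|_] /=; rewrite /upd /= st.
      rewrite ltlexS; case/orP=> [/andP[/eqP-> /eqP->] _|l f].
        by right; split=> //; move: (l1 fX); rewrite hz.
      by case: (h1 _ _ cC' tT' l f) => [|[_ _]]; [left|rewrite hz].
    move=> /andP[_ hz1]; split=> // u /andP[u1 u2].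
    by have -> : u = t.+1 by lia.
  have [q1 q2 q3] := h2 cC hz.
  have qT : (nmem s1 12 0 <= T)%N by lia.
  split=> [c' t' cC' tT'|_] /=; last first.
    rewrite /upd /= st => /andP[_ hz1]; split=> // u /andP[u1 u2].
    by have -> : u = t.+1 by lia.
  rewrite /ncell /= /upd /= sc st sB // !cell_inj // => l f.
  left; case: eqP l f => /= [->|nc] l f; last first.
    case: (h1 c' t') => //; last by case.
    by move: l; rewrite ltlexS; case: eqP nc.
  case: eqP => [->|nq].
    split=> // [|u ul]; first by rewrite gtn_eqF.
    by apply: q3; move: ul; rewrite /minn /maxn q1.
  case: eqP l f => [-> _ _|nt l f].
    split=> // [|u ul]; first by rewrite ltn_eqF.
    by apply: q3; move: ul; rewrite minnC maxnC /minn /maxn q1.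
  rewrite ltlexS (introF eqP nt) andbF /= in l.
  by case: (h1 _ _ cC tT' l f) => // -[_ ].
move=> [h1 _] c t cC tT f; case: (h1 c t cC tT (ltlex_end _ cC) f) => // -[e].
by move: cC; rewrite e ltnn.
Qed.

Lemma run_start s : std C T s -> nmem s 13 0 = 0%N ->
  let s' := run p_start s in
  let c0 := nmem s' 16 0 in let t0 := nmem s' 17 0 in
  (nmem s' 13 0 = 0%N -> forall c t, (c < C)%N -> (t <= T)%N -> frac (X s c t) = false) /\
  (nmem s' 13 0 != 0%N -> [/\ (c0 < C)%N, (t0 <= T)%N, frac (X s c0 t0) &
     nmem s 10 t0 != 0%N -> forall c t, (c < C)%N -> (t <= T)%N -> frac (X s c t) ->
       nmem s 10 t != 0%N]).
Proof.
move=> ss f0 s' c0 t0.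
pose Q c t (f c0 t0 : nat) :=
  (f = 0%N -> forall c' t', (c' < C)%N -> (t' <= T)%N -> ltlex c' t' c t ->
     frac (X s c' t') = false) /\
  (f != 0%N -> [/\ (c0 < C)%N, (t0 <= T)%N, frac (X s c0 t0) &
     nmem s 10 t0 != 0%N -> forall c' t', (c' < C)%N -> (t' <= T)%N ->
       ltlex c' t' c t -> frac (X s c' t') -> nmem s 10 t' != 0%N]).
pose J c t s1 := Q c t (nmem s1 13 0) (nmem s1 16 0) (nmem s1 17 0).
have : J C 0%N s'.
  apply: (run_for2 ss) => //.
  - by split=> [_ c' t' _ _|]; [rewrite ltlex0|rewrite f0].
  - move=> c s1 [h1 h2]; split=> [e c' t' cC' tT'|/h2[a1 a2 a3 a4]].
      by rewrite -(ltlex_row _ _ tT'); apply: h1.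
    split=> // b c' t' cC' tT'.
    by rewrite -(ltlex_row _ _ tT'); apply: a4.
  move=> c t s1 cC tT [_ _ sB] sc st sn sr [h1 h2].
  have eX : reval s1 (RGet 3 (cell vc vt)) = X s c t.
    by rewrite /= sc st sB // sr.
  have e10 : nmem s1 10 = nmem s 10 by rewrite sn.
  rewrite run_if beval_and beval_frac eX /= st e10 !lt0n.
  case: ifP => [/andP[fX cond]|cond]; last first.
    split=> [e|/h2[a1 a2 a3 a4]].
      move=> c' t' cC' tT'; rewrite ltlexS => /orP[/andP[/eqP-> /eqP->]|].
        by move: cond; rewrite /= e /= andbT.
      exact: h1.
    split=> // b c' t' cC' tT'.
    rewrite ltlexS => /orP[/andP[/eqP-> /eqP->] fX|]; last exact: a4.
    by move: cond; rewrite fX /= => /negbFE/andP[_].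
  split=> //= _; rewrite /upd /= sc st; split=> // b c' t' cC' tT'.
  rewrite ltlexS => /orP[/andP[/eqP-> /eqP->] //|l f].
  move: cond; rewrite b andbT negbK => /eqP e.
  by rewrite (h1 e c' t') in f.
move=> [h1 h2]; split=> [e c t cC tT|/h2[a1 a2 a3 a4]].
  by apply: h1 => //; apply: ltlex_end.
by split=> // b c t cC tT; apply: a4 => //; apply: ltlex_end.
Qed.
(** A walk still open after [T.+1] rounds would have [T.+2] departures, against [walk_size]. *)
Lemma run_walk s : std C T s -> nmem s 21 0 = 0%N -> nmem s 20 0 = 0%N ->
  (forall t, (t <= T)%N -> nmem s 18 t = 0%N) ->
  let A := nmem s 9 in let B := nmem s 10 in let P := ncell s 11 in
  let prot t := B t != 0%N in
  cols_spec s A B ->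
  (forall c t, (c < C)%N -> (t <= T)%N -> frac (X s c t) ->
     partner_ok T (X s) (Z s) P c t) ->
  (nmem s 13 0 != 0%N ->
     [/\ (nmem s 16 0 < C)%N, (nmem s 17 0 <= T)%N, frac (X s (nmem s 16 0) (nmem s 17 0))
     & prot (nmem s 17 0) -> forall c t, (c < C)%N -> (t <= T)%N -> frac (X s c t) ->
       prot t]) ->
  let s' := run p_walk s in
  if nmem s 13 0 == 0%N then nmem s' 21 0 = 0%N
  else closed_walk C T (X s) prot P (nmem s' 16) (nmem s' 17) (nmem s' 20 0)
         (nmem s' 21 0).
Proof.
move=> ss s21 s20 s18 A B P prot cs pok st s'; have [_ sT _] := ss.
case: ifP => [/eqP s13|/negbT s13].
  pose J (j : nat) (s1 : state R) := nmem s1 13 0 = 0%N /\ nmem s1 21 0 = 0%N.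
  suff : J T.+1 s' by case.
  rewrite /s' -addn1 -sT /p_walk; set p := (X in PFor _ _ _ X).
  apply: (@run_for R J 8%N 1%N 1%N p s) => // j s1 _ _ _ _ [h1 h2].
  by rewrite /p run_if /= h1.
have {st}[c0C t0T f0 st] := st s13.
(* Before round [j] an open walk has [j.+1] departures, the last of which is not yet marked in array
   18. Conversely, every mark points back to its column. *)
pose J (j : nat) (s1 : state R) :=
  (nmem s1 13 0 != 0%N /\
   [/\ walk C T (X s) prot P (nmem s1 16) (nmem s1 17) j.+1, nmem s1 20 0 = 0%N,
       nmem s1 17 0 = nmem s 17 0,
       forall k, (k < j)%N -> nmem s1 18 (nmem s1 17 k) = k.+1
     & forall t, (t <= T)%N -> nmem s1 18 t != 0%N ->
        (nmem s1 18 t <= j)%N /\ nmem s1 17 (nmem s1 18 t).-1 = t]) \/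
  (nmem s1 13 0 = 0%N /\
   closed_walk C T (X s) prot P (nmem s1 16) (nmem s1 17) (nmem s1 20 0)
         (nmem s1 21 0)).
suff : J T.+1 s'.
  by case=> -[_ //] [/walk_size]; rewrite ltnn.
rewrite /s' -addn1 -sT /p_walk; set p := (X in PFor _ _ _ X).
apply: (@run_for R J 8%N 1%N 1%N p s) => //.
  left; split=> //; split=> //; last by move=> t tT; rewrite /= /upd /= s18.
  split=> [[|k] //|[|k] //|[|k] [|l] //] _ /=.
move=> j s1 jT sk sn sr [[h1 [wk h20 h17 hk hm]]|[h1 cw]]; last first.
  by right; rewrite /p run_if /= h1.
have [w1 w2 w3] := wk.
have [cC tT fX] := w1 j (leqnn _).
set c := nmem s1 16 j in cC fX; set t := nmem s1 17 j in tT fX.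
have [pT pt fp _] := pok _ _ cC tT fX.
have [_ _ sB] := ss.
have ep : nmem s1 11 (nmem s1 2 c + c + t)%N = P c t.
  by rewrite !sn // sB.
have e9 : nmem s1 9 = A by rewrite sn.
have e10 : nmem s1 10 = B by rewrite sn.
rewrite /p run_if /= lt0n h1 /= !/(upd _ 15 _ _ _ _) /upd /= sk -/c -/t ep addn1.
rewrite e9 e10 (negPf pt) leqn0 lt0n.
case: eqP => Bp.
  right; split=> //; change (closed_walk C T (X s) prot P (nmem s1 16) (nmem s1 17)
    (nmem s1 20 0) j.+1).
  split; rewrite ?h20 //; right; split=> //=.
    by rewrite /arrival -/c -/t /prot Bp.
  (* The start is unprotected as well: a protected start would mean that every column with a
     fractional entry is protected, including the one just reached. *)
  by rewrite h17; apply/negP => /st/(_ c (P c t) cC pT fp); rewrite /prot Bp.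
case: eqP => mp /=; last first.
  have [mj mE] := hm _ pT (introN eqP mp).
  right; split=> //; change (closed_walk C T (X s) prot P (nmem s1 16) (nmem s1 17)
    (nmem s1 18 (P c t) - 1)%N j.+1).
  have m1 : (nmem s1 18 (P c t) - 1 = (nmem s1 18 (P c t)).-1)%N by lia.
  by split=> //; rewrite m1; [lia|left; rewrite mE].
have [c1 c2 c3 c4] := cs _ pT.
have [Ap BC PT fB AB] := c3 (introN eqP Bp).
have /andP[AC fA] := c2 Ap.
have fresh k : (k <= j)%N -> nmem s1 17 k <> P c t.
  rewrite leq_eqVlt => /orP[/eqP->|kj e]; first by apply/eqP; rewrite eq_sym.
  by have := hk _ kj; rewrite e mp.
set c' := if (A (P c t) <= c + 1 <= A (P c t))%N then (B (P c t) - 1)%N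
          else (A (P c t) - 1)%N.
have c'P : [/\ (c' < C)%N, frac (X s c' (P c t)) & c != c'].
  rewrite /c' -eqn_leq; case: eqP => e; rewrite subn1; split=> //.
    by apply: contra_neq AB => ec; lia.
  by apply/eqP => ec; apply: e; lia.
have [c'C fc' cc'] := c'P.
set ec' := fun k => if k == j.+1 then c' else nmem s1 16 k.
set es' := fun k => if k == j.+1 then P c t else nmem s1 17 k.
have keep k : (k <= j)%N -> ec' k = nmem s1 16 k /\ es' k = nmem s1 17 k.
  by move=> kj; rewrite /ec' /es' ltn_eqF.
have wk' : walk C T (X s) prot P ec' es' j.+2.
  apply: (walk_rcons wk keep); rewrite /ec' /es' ?eqxx //.
  exact/eqP.
have main : forall s2 : state R, nmem s2 13 0 = nmem s1 13 0 ->
    nmem s2 16 =1 ec' -> nmem s2 17 =1 es' -> nmem s2 20 0 = nmem s1 20 0 ->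
    (forall i, nmem s2 18 i = if i == t then j.+1 else nmem s1 18 i) -> J j.+1 s2.
  move=> s2 g13 g16 g17 g20 g18; left; split; first by rewrite g13.
  split; rewrite ?g17 ?g20 //.
  - have [x1 x2 x3] := wk'; split=> [k kj|k kj|k l kj lj].
    + by rewrite g16 g17; apply: x1.
    + by rewrite !g16 !g17; apply: x2.
    by rewrite !g17; apply: x3.
  - move=> k; rewrite ltnS leq_eqVlt => /orP[/eqP->|kj].
      by rewrite g17; have [_ ->] := keep _ (leqnn j); rewrite g18 eqxx.
    rewrite g17; have [_ ->] := keep _ (ltnW kj); rewrite g18 hk //.
    by case: eqP => // /w3 e; have := e (ltnW kj) (leqnn _); lia.
  move=> u uT; rewrite g18 g17; case: (u =P t) => [-> _|_ /(hm _ uT) [m1 m2]] /=.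
    by have [_ ->] := keep _ (leqnn j).
  by split; [lia|have [|_ ->] := keep (nmem s1 18 u).-1; [lia|]].
by case: ifP => e; apply: main => // k; rewrite /= /upd /= /ec' /c' e.
Qed.

End Phases.

(** * The phases that compute with reals: flow, prefix sums, step length, move and output *)

Section Numeric.
Variables (R : realType) (C T : nat).
Implicit Types s : state R.
Let X s := rcell T s 3.
Let Z s := rcell T s 4.
Let W s := rcell T s 5.
Let DZ s := rcell T s 6.

Lemma run_flow s : std C T s ->
  let ec := nmem s 16 in let es := nmem s 17 in let P := ncell T s 11 in
  let k0 := nmem s 20 0 in let K := nmem s 21 0 in
  (K <= T.+1)%N ->
  (forall k, (k < K)%N -> [/\ (ec k < C)%N, (es k <= T)%N & (P (ec k) (es k) <= T)%N]) ->
  (forall c t, (c < C)%N -> (t <= T)%N -> W s c t = 0) ->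
  forall c t, (c < C)%N -> (t <= T)%N ->
    W (run p_flow s) c t = flow (rmem s 0) P ec es k0 K c t.
Proof.
move=> ss ec es P k0 K KT wk w0; have [_ sT sB] := ss.
pose J (j : nat) (s1 : state R) := forall c t, (c < C)%N -> (t <= T)%N ->
  W s1 c t = \sum_(k0 <= k < minn j K) flow_at (rmem s 0) P ec es k c t.
suff : J T.+1 (run p_flow s) by move=> h c t cC tT; rewrite h // (minn_idPr KT).
rewrite -addn1 -sT /p_flow; set p := (X in PFor _ _ _ X).
apply: (@run_for R J 8%N 1%N 1%N p s) => //.
  by move=> c t cC tT; rewrite min0n big_geq //; apply: w0.
move=> j s1 jT sk sn sr h c t cC tT.
rewrite /p run_if /= sk !sn // -/k0 -/K addn1.
case: ifP => [/andP[k0j jK]|out]; last first.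
  have -> : \sum_(k0 <= k < minn j.+1 K) flow_at (rmem s 0) P ec es k c t =
            \sum_(k0 <= k < minn j K) flow_at (rmem s 0) P ec es k c t.
    case: (boolP (K <= j)%N) => [Kj|]; last rewrite -ltnNge => jK.
      by rewrite (minn_idPr Kj) (minn_idPr (leqW Kj)).
    have jk0 : (j < k0)%N by move: out; rewrite jK andbT; lia.
    by rewrite !big_geq // (minn_idPl _) // ltnW.
  exact: h.
have [eC sT' aT] := wk _ jK.
rewrite (minn_idPl jK) big_nat_recr //=.
have -> : \sum_(k0 <= k < j) flow_at (rmem s 0) P ec es k c t = W s1 c t.
  by rewrite h // (minn_idPl (ltnW jK)).
have e16 : nmem s1 16 = ec by rewrite sn.
have e17 : nmem s1 17 = es by rewrite sn.
have e2 c' : (c' < C)%N -> nmem s1 2 c' = (c' * T)%N by move=> ?; rewrite sn ?sB.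
have e11 : nmem s1 11 (ec j * T + ec j + es j)%N = P (ec j) (es j) by rewrite sn.
rewrite /flow_at /W /rcell /upd /= sk -?[nmem s 16]/ec -?[nmem s 17]/es ?sB //.
rewrite !(e16, e17) !e2 // !e11 (sr 0%N) // !cell_inj // !eqxx /= div1r /arrival.
rewrite [c == _]eq_sym [t == es j]eq_sym [t == P _ _]eq_sym.
case: (ec j =P c) => [->|_] /=; last by rewrite addr0.
(* Departure and arrival are not assumed distinct here. If they coincide, the second update acts on
   the result of the first. *)
case: (es j =P t) => [e1|n1]; case: (P _ _ =P t) => [e2'|n2] /=.
- by rewrite e2' e1 eqxx; ring.
- by rewrite e1; ring.
- by rewrite e2'; case: (t =P es j) => [/esym//|_]; ring.
by ring.
Qed.

Lemma run_prefix s : std C T s ->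
  forall c t, (c < C)%N -> (t <= T)%N ->
    DZ (run p_prefix s) c t = \sum_(u < t) W s c u.
Proof.
move=> ss; have [sC sT sB] := ss; rewrite /p_prefix.
set p := (X in PFor _ _ _ X).
pose I j (s1 : state R) := forall c t, (c < j)%N -> (t <= T)%N ->
  DZ s1 c t = \sum_(u < t) W s c u.
suff : I C (run (forC p) s) by [].
rewrite -[C]addn0 -sC; apply: (@run_for R I 6%N 0%N 0%N p s) => //.
move=> j s1; rewrite addn0 sC => jC sj sn sr h.
rewrite /p run_seq; set s2 := run (PR _ _ _) s1; set q := (X in PFor _ _ _ X).
have s1T : nmem s2 0 1 = T by rewrite /= sn.
pose I2 i (s3 : state R) := [/\ forall c t, (c < j)%N -> (t <= T)%N ->
  DZ s3 c t = \sum_(u < t) W s c u,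
  forall t, (t < i)%N -> (t <= T)%N -> DZ s3 j t = \sum_(u < t) W s j u
  & rmem s3 9 0 = \sum_(u < i) W s j u].
suff : I2 T.+1 (run (forS q) s2).
  case=> h1 h2 _ c t; rewrite ltnS leq_eqVlt => /orP[/eqP->|cj] tT.
    exact: h2.
  exact: h1.
rewrite -addn1 -s1T; apply: (@run_for R I2 7%N 1%N 1%N q s2) => //.
  by split=> //; rewrite big_ord0.
move=> i s3; rewrite addn1 s1T => iT si sn3 sr3 [h1 h2 h3].
have s3j : nmem s3 6 0 = j by rewrite sn3.
have s3B : nmem s3 2 j = (j * T)%N by rewrite sn3 //= sn // sB.
have eW : rmem s3 5 (j * T + j + i)%N = W s j i.
  by rewrite sr3 //= /upd /= sr.
split=> [c t cj tT|t|] /=.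
- rewrite /DZ /rcell /upd /= si s3j s3B cell_inj // (ltn_eqF cj) /=.
  exact: h1.
- rewrite ltnS leq_eqVlt /DZ /rcell /upd /= si s3j s3B => /orP[/eqP->|ti] tT.
    by rewrite eqxx h3.
  by rewrite cell_inj // (ltn_eqF ti) andbF; apply: h2.
by rewrite /upd /= si s3j s3B eW h3 big_ord_recr.
Qed.

Lemma run_max s e : let s' := run (p_max e) s in
  [/\ nmem s' = nmem s, forall a, a != 7%N -> rmem s' a = rmem s a,
      rmem s 7 0 <= rmem s' 7 0, reval s e <= rmem s' 7 0
    & rmem s' 7 0 = rmem s 7 0 \/ rmem s' 7 0 = reval s e].
Proof.
rewrite /p_max run_if; case: ifP => /= h.
  split=> //; last by right.
  by move=> a /negPf a7; rewrite /upd a7.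
by split=> //; [apply/ltW; rewrite ltNge h|left].
Qed.

Lemma run_ratio s : std C T s -> rmem s 7 0 = 0 ->
  max_ratio C T (X s) (Z s) (W s) (DZ s) (rmem (run p_ratio s) 7 0).
Proof.
move=> ss mu0.
pose J c t (s1 : state R) := [/\ 0 <= rmem s1 7 0,
  forall c' t', (c' < C)%N -> (t' <= T)%N -> ltlex c' t' c t ->
        [/\ W s c' t' / (1 - X s c' t') <= rmem s1 7 0,
            - W s c' t' / X s c' t' <= rmem s1 7 0,
            DZ s c' t' / (1 - Z s c' t') <= rmem s1 7 0
          & - DZ s c' t' / Z s c' t' <= rmem s1 7 0]
  & rmem s1 7 0 = 0 \/ exists c t, [/\ (c < C)%N, (t <= T)%N &
        (rmem s1 7 0 = W s c t / (1 - X s c t) \/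
         rmem s1 7 0 = - W s c t / X s c t) \/
        (rmem s1 7 0 = DZ s c t / (1 - Z s c t) \/
         rmem s1 7 0 = - DZ s c t / Z s c t)]].
have : J C 0%N (run p_ratio s).
  apply: (run_for2 ss) => //.
  - split; rewrite ?mu0 //; last by left.
    by move=> c' t' _ _; rewrite ltlex0.
  - move=> c s1 [h1 h2 h3]; split=> // c' t' cC' tT'.
    by rewrite -(ltlex_row _ _ tT'); apply: h2.
  move=> c t s1 cC tT [_ _ sB] sc st _ sr [h1 h2 h3].
  (* The four comparisons write to array 7 alone, so all the ratios are computed from the original
     entries. *)
  have rd s2 a : nmem s2 = nmem s1 -> (forall b, b != 7%N -> rmem s2 b = rmem s1 b) ->
      a != 7%N -> reval s2 (RGet a (cell vc vt)) = rcell T s a c t.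
    by move=> e1 e2 a7; rewrite /= e1 e2 // sc st sB // sr //= !inE !(negPf a7).
  rewrite /p_max2 !run_seq.
  set e4 := RDiv _ _; set e3 := RDiv _ _; set e2 := RDiv _ _; set e1 := RDiv _ _.
  have [n1 r1 m1 g1 o1] := run_max s1 e1.
  set s2 := run (p_max e1) s1 in n1 r1 m1 g1 o1 *.
  have [n2 r2 m2 g2 o2] := run_max s2 e2.
  set s3 := run (p_max e2) s2 in n2 r2 m2 g2 o2 *.
  have [n3 r3 m3 g3 o3] := run_max s3 e3.
  set s4 := run (p_max e3) s3 in n3 r3 m3 g3 o3 *.
  have [n4 r4 m4 g4 o4] := run_max s4 e4.
  set s5 := run (p_max e4) s4 in n4 r4 m4 g4 o4 *.
  have E1 : reval s1 e1 = W s c t / (1 - X s c t).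
    have u := rd s1 5%N; have v := rd s1 3%N.
    by rewrite /= in u v; rewrite /e1 /= u ?v //.
  have E2 : reval s2 e2 = - W s c t / X s c t.
    have u := rd s2 5%N; have v := rd s2 3%N.
    by rewrite /= in u v; rewrite /e2 /= u ?v // sub0r.
  rewrite n1 in n2.
  have {}r2 b : b != 7%N -> rmem s3 b = rmem s1 b by move=> b7; rewrite r2 ?r1.
  have E3 : reval s3 e3 = DZ s c t / (1 - Z s c t).
    have u := rd s3 6%N; have v := rd s3 4%N.
    by rewrite /= in u v; rewrite /e3 /= u ?v //.
  rewrite n2 in n3.
  have {}r3 b : b != 7%N -> rmem s4 b = rmem s1 b by move=> b7; rewrite r3 ?r2.
  have E4 : reval s4 e4 = - DZ s c t / Z s c t.
    have u := rd s4 6%N; have v := rd s4 4%N.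
    by rewrite /= in u v; rewrite /e4 /= u ?v // sub0r.
  rewrite E1 in g1 o1; rewrite E2 in g2 o2; rewrite E3 in g3 o3; rewrite E4 in g4 o4.
  have k3 := le_trans m3 m4; have k2 := le_trans m2 k3; have k1 := le_trans m1 k2.
  have here : exists c t, [/\ (c < C)%N, (t <= T)%N &
        (rmem s5 7 0 = W s c t / (1 - X s c t) \/
         rmem s5 7 0 = - W s c t / X s c t) \/
        (rmem s5 7 0 = DZ s c t / (1 - Z s c t) \/
         rmem s5 7 0 = - DZ s c t / Z s c t)] \/ rmem s5 7 0 = rmem s1 7 0.
    exists c, t; case: o4 => ->; last by left; split=> //; right; right.
    case: o3 => ->; last by left; split=> //; right; left.
    case: o2 => ->; last by left; split=> //; left; right.
    by case: o1 => ->; [right|left; split=> //; left; left].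
  split; first exact: le_trans h1 k1.
  - move=> c' t' cC' tT'; rewrite ltlexS => /orP[/andP[/eqP-> /eqP->]|l].
      change (rmem (setn _ _ s5) 7 0) with (rmem s5 7 0).
      by split=> //; [apply: le_trans k2|apply: le_trans k3|apply: le_trans m4].
    have [a1 a2 a3 a4] := h2 _ _ cC' tT' l.
    change (rmem (setn _ _ s5) 7 0) with (rmem s5 7 0).
    by split; apply: le_trans k1.
  change (rmem (setn _ _ s5) 7 0) with (rmem s5 7 0).
  by case: here => c1 [t1 [h|->]] //; right; exists c1, t1.
move=> [h1 h2 h3]; split=> // c t cC tT.
by apply: h2 => //; apply: ltlex_end.
Qed.

Lemma run_move s : std C T s ->
  forall c t, (c < C)%N -> (t <= T)%N ->
    X (run p_move s) c t = X s c t + W s c t / rmem s 7 0 /\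
    Z (run p_move s) c t = Z s c t + DZ s c t / rmem s 7 0.
Proof.
move=> ss.
pose J c t (s1 : state R) := forall c' t', (c' < C)%N -> (t' <= T)%N ->
  X s1 c' t' = (if ltlex c' t' c t then X s c' t' + W s c' t' / rmem s 7 0
                else X s c' t') /\
  Z s1 c' t' = (if ltlex c' t' c t then Z s c' t' + DZ s c' t' / rmem s 7 0
                else Z s c' t').
have : J C 0%N (run p_move s).
  apply: (run_for2 ss) => //.
  - by move=> c' t' _ _; rewrite ltlex0.
  - by move=> c s1 h c' t' cC' tT'; rewrite -(ltlex_row _ _ tT'); apply: h.
  move=> c t s1 cC tT [_ _ sB] sc st _ sr h c' t' cC' tT'.
  have [hX hZ] := h _ _ cC tT; rewrite ltlex_irr in hX hZ.
  have [hX' hZ'] := h _ _ cC' tT'.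
  rewrite ltlexS /X /Z /rcell /= /upd /= sc st sB // !cell_inj //.
  rewrite (sr 5%N) // (sr 6%N) // (sr 7%N) //.
  case: ifP => /= [/andP[/eqP-> /eqP->]|_]; last by split.
  by rewrite -[rmem s1 3 _]/(X s1 c t) -[rmem s1 4 _]/(Z s1 c t) hX hZ.
by move=> h c t cC tT; have := h c t cC tT; rewrite ltlex_end.
Qed.

Lemma run_out s : std C T s ->
  forall c t, (c < C)%N -> (t < T)%N -> rmem (run p_out s) 2 (c * T + t)%N = X s c t.
Proof.
move=> ss; have [sC sT sB] := ss; rewrite /p_out.
set p := (X in PFor _ _ _ X).
pose I j (s1 : state R) := forall c t, (c < j)%N -> (t < T)%N ->
  rmem s1 2 (c * T + t)%N = X s c t.
suff : I C (run (forC p) s) by [].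
rewrite -[C]addn0 -sC; apply: (@run_for R I 6%N 0%N 0%N p s) => //.
move=> j s1; rewrite addn0 sC => jC sj sn sr h.
rewrite /p; set q := (X in PFor _ _ _ X).
have s1T : nmem s1 0 1 = T by rewrite sn.
pose I2 i (s3 : state R) := forall c t, ltlex c t j i -> (t < T)%N ->
  rmem s3 2 (c * T + t)%N = X s c t.
suff : I2 T (run (forT q) s1).
  by move=> h2 c t cj tT; apply: h2 => //; rewrite ltlex_rowT // /ltlex cj.
rewrite -[T]addn0 -s1T; apply: (@run_for R I2 7%N 1%N 0%N q s1) => //.
  by move=> c t; rewrite /ltlex andbF orbF; apply: h.
move=> i s3; rewrite addn0 s1T => iT si sn3 sr3 h3 c t l tT.
have s3j : nmem s3 6 0 = j by rewrite sn3.
have s3B : nmem s3 2 j = (j * T)%N by rewrite sn3 // sn // sB.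
have eX : rmem s3 3 = rmem s 3 by rewrite sr3 //= sr.
rewrite /= /upd /= si s3j s3B rowcell_inj // eX.
case: ifP => [/andP[/eqP-> /eqP->] //|ne].
by apply: h3 => //; move: l; rewrite ltlexS ne.
Qed.

End Numeric.

(** * The main loop *)

Section Main.
Variables (R : realType) (C T : nat).
Implicit Types s : state R.
Let X s := rcell T s 3.
Let Z s := rcell T s 4.

Lemma run_base s : nmem s 0 0 = C -> nmem s 0 1 = T -> nmem s 2 0 = 0%N ->
  std C T (run p_base s).
Proof.
move=> sC sT s2; rewrite /p_base; set p := (X in PFor _ _ _ X).
split; [by rewrite run_nmem | by rewrite run_nmem |].
pose I j (s1 : state R) := forall c, (c <= j)%N -> nmem s1 2 c = (c * T)%N.
suff : I C (run (forC p) s) by move=> h c /ltnW/h.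
rewrite -[C]addn0 -sC; apply: (@run_for R I 6%N 0%N 0%N p s) => //.
  by case.
move=> j s1 _ sj sn _ h c; rewrite /= /upd /= sj addn1.
rewrite leq_eqVlt ltnS => /orP[/eqP->|cj].
  by rewrite eqxx h // sn // sT; lia.
by rewrite ltn_eqF // h.
Qed.

(* The fractional part of [f 0 + ... + f (t - 1)] when [0 <= f <= 1]. *)
Fixpoint fpart (f : nat -> R) (t : nat) : R :=
  if t is t'.+1 then
    let v := fpart f t' + f t' in if 1 <= v then v - 1 else v
  else 0.

Lemma run_init s : std C T s ->
  let y c t := rmem s 1 (c * T + t)%N in
  forall c, (c < C)%N ->
  [/\ forall t, (t <= T)%N -> Z (run p_init s) c t = fpart (y c) t,
      forall t, (t < T)%N -> X (run p_init s) c t = y c t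
    & X (run p_init s) c T = 1 - fpart (y c) T].
Proof.
move=> ss y; have [sC sT sB] := ss; rewrite /p_init.
set p := (X in PFor _ _ _ X).
pose I j (s1 : state R) := forall c, (c < j)%N ->
  [/\ forall t, (t <= T)%N -> Z s1 c t = fpart (y c) t,
      forall t, (t < T)%N -> X s1 c t = y c t
    & X s1 c T = 1 - fpart (y c) T].
suff : I C (run (forC p) s) by [].
rewrite -[C]addn0 -sC; apply: (@run_for R I 6%N 0%N 0%N p s) => //.
move=> j s1; rewrite addn0 sC => jC sj sn sr h.
rewrite /p 3!run_seq; set s2 := run (PR _ _ _) s1.
set q := (X in PFor _ _ _ X).
have s2T : nmem s2 0 1 = T by rewrite /= sn.
pose I2 i (s3 : state R) := [/\ I j s3,
  forall t, (t < i)%N -> (t <= T)%N -> Z s3 j t = fpart (y j) t /\ X s3 j t = y j t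
  & rmem s3 9 0 = fpart (y j) i].
have : I2 T (run (forT q) s2).
  rewrite -[T]addn0 -s2T; apply: (@run_for R I2 7%N 1%N 0%N q s2) => //.
  move=> i s3; rewrite addn0 s2T => iT si sn3 sr3 [h1 h2 h3].
  have s3j : nmem s3 6 0 = j by rewrite sn3.
  have s3B : nmem s3 2 j = (j * T)%N by rewrite sn3 //= sn // sB.
  have ey : rmem s3 1 (j * T + i)%N = y j i by rewrite sr3 //= /upd /= sr.
  have iT' := ltnW iT; rewrite /q 3!run_seq; set s4 := run (PR 9 _ _) _.
  have e4 : [/\ I j s4,
    forall t, (t < i.+1)%N -> (t <= T)%N -> Z s4 j t = fpart (y j) t /\ X s4 j t = y j t
    & rmem s4 9 0 = fpart (y j) i + y j i].
    split.
    - move=> c cj; have [a1 a2 a3] := h1 c cj.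
      by split=> [t tT|t /[dup] tT /ltnW tT'|];
         rewrite /Z /X /rcell /= /upd /= si s3j s3B cell_inj //
           (ltn_eqF cj); [apply: a1|apply: a2|].
    - move=> t; rewrite ltnS leq_eqVlt => ti tT.
      rewrite /Z /X /rcell /= /upd /= si s3j s3B cell_inj //.
      rewrite eqxx /=; case: eqP ti => [-> _|_ /= ti]; first by rewrite h3 ey.
      exact: h2.
    by rewrite /= /upd /= si s3j s3B ey h3.
  clearbody s4; have [g1 g2 g3] := e4; rewrite run_if.
  have -> : beval s4 (RLe (RConst 1) (RGet 9 (NConst 0))) = (1 <= fpart (y j) i + y j i).
    by rewrite [LHS]/= g3.
  case: ifP => le1.
    by split=> //; rewrite /= /upd /= ?g3 le1.
  by split=> //; rewrite /= ?g3 le1.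
move: (run (forT q) s2) (@run_nmem R (forT q) s2) => s3 sn3 [h1 h2 h3].
have s3j : nmem s3 6 0 = j by rewrite sn3.
have s3B : nmem s3 2 j = (j * T)%N by rewrite sn3 //= sn // sB.
have s3T : nmem s3 0 1 = T by rewrite sn3.
move=> c; rewrite ltnS leq_eqVlt => /orP[/eqP->|cj].
  split=> [t tT|t /[dup] tT /ltnW tT'|];
    rewrite /Z /X /rcell /= /upd /= s3j s3B s3T ?cell_inj //.
  - rewrite eqxx /=; case: eqP => [->|/eqP tn]; first by rewrite h3.
    have tT' : (t < T)%N by rewrite ltn_neqAle tn.
    by have [] := h2 t tT' tT.
  - rewrite (ltn_eqF tT) andbF.
    by have [] := h2 t tT (ltnW tT).
  by rewrite !eqxx /= h3.
have [a1 a2 a3] := h1 c cj.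
by split=> [t tT|t /[dup] tT /ltnW tT'|];
   rewrite /Z /X /rcell /= /upd /= s3j s3B s3T cell_inj // (ltn_eqF cj);
   [apply: a1|apply: a2|].
Qed.

Section Iteration.
Variables (E : nat -> R) (y dd z0 : nat -> nat -> R).
Hypothesis E0 : forall c, (c < C)%N -> E c != 0.
Hypothesis dd01 : forall c t, dd c t = 0 \/ dd c t = 1.
Hypothesis z00 : forall c, z0 c 0%N = 0.

Definition good s := [/\ std C T s, rmem s 0 = E & inv C T E y dd z0 (X s) (Z s)].

Definition integral s := forall c t, (c < C)%N -> (t <= T)%N -> frac (X s c t) = false.

(** If no start is found, all entries are integral, the flow is empty and nothing moves. Otherwise
    the flow along the closed walk is a nonzero direction, and [nfrac_move] applies. *)
Lemma run_iter s : good s -> let s' := run p_iter s in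
  good s' /\ (integral s' \/ ~ integral s /\
    (nfrac C T (X s') (Z s') < nfrac C T (X s) (Z s))%N).
Proof.
move=> [ss sE iv]; have [bnd lnk hz _] := iv; rewrite /p_iter 8!run_seq.
have [c1 c2 c3 [c4 c5 c6]] := run_clear ss.
move s1E : (run p_clear s) c1 c2 c3 c4 c5 c6 => s1 A1 W1 mu1 f1 K1 k1.
have ss1 : std C T s1 by rewrite -s1E; apply: std_run.
have r1 a : a \in [:: 0; 3; 4]%N -> rmem s1 a = rmem s a.
  by rewrite !inE => /or3P[]/eqP->; rewrite -s1E run_rmem.
have cs : cols_spec C T s1 (nmem (run p_cols s1) 9) (nmem (run p_cols s1) 10).
  by apply: run_cols => // t tT; have [] := A1 t tT.
move s2E : (run p_cols s1) cs => s2 cs.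
have ss2 : std C T s2 by rewrite -s2E; apply: std_run.
have r2 a : rmem s2 a = rmem s1 a by rewrite -s2E run_rmem.
have X2 : rcell T s2 3 = X s by rewrite /X /rcell r2 r1.
have Z2 : rcell T s2 4 = Z s by rewrite /Z /rcell r2 r1.
have zs c : (c < C)%N -> frac (Z s c 0) = false.
  by move=> cC; rewrite (hz c 0%N) // /frac ltxx.
have link c t : (c < C)%N -> (t <= T)%N ->
     (frac (X s c t) -> frac (Z s c t) || ((t.+1 <= T)%N && frac (Z s c t.+1))) /\
     (frac (X s c t) = false ->
      frac (Z s c t) = (t.+1 <= T)%N && frac (Z s c t.+1)).
  move=> cC tT; have [bX bZ] := bnd _ _ cC tT.
  (* No z follows the virtual column; the integral value 0 takes its place, in accordance with the
     integral row sum. *)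
  set n := if (t < T)%N then Z s c t.+1 else 0.
  have bn : 0 <= n <= 1.
    by rewrite /n; case: ltnP => [tT'|_]; [have [] := bnd _ _ cC tT'|rewrite lexx ler01].
  have <- : frac n = (t.+1 <= T)%N && frac (Z s c t.+1).
    by rewrite /n; case: ltnP => // _; rewrite /frac ltxx.
  exact: (frac_link (dd01 c t) bX bn bZ (lnk _ _ cC tT)).
have pok : forall c t, (c < C)%N -> (t <= T)%N -> frac (X s c t) ->
    partner_ok T (X s) (Z s) (ncell T (run p_partner s2) 11) c t.
  have := run_partner ss2; rewrite X2 Z2; apply=> // c t cC tT.
  by rewrite tT; apply: link.
move s3E : (run p_partner s2) pok => s3 pok.
have ss3 : std C T s3 by rewrite -s3E; apply: std_run.
have r3 a : rmem s3 a = rmem s1 a by rewrite -s3E run_rmem.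
have n3 a : a \notin nwrites p_cols ++ nwrites p_partner -> nmem s3 a = nmem s1 a.
  by rewrite mem_cat => /norP[h1 h2]; rewrite -s3E -s2E !run_nmem.
have n32 a : a \notin nwrites p_partner -> nmem s3 a = nmem s2 a.
  by move=> h1; rewrite -s3E run_nmem.
have X3 : rcell T s3 3 = X s by rewrite /X /rcell r3 r1.
have f3 : nmem s3 13 0 = 0%N by rewrite n3.
have st := run_start ss3 f3.
rewrite X3 in st.
move s4E : (run p_start s3) st => s4 [st0 st1].
have ss4 : std C T s4 by rewrite -s4E; apply: std_run.
have r4 a : rmem s4 a = rmem s1 a by rewrite -s4E run_rmem.
have n4 a : a \notin nwrites p_start -> nmem s4 a = nmem s3 a.
  by move=> h1; rewrite -s4E run_nmem.
have X4 : rcell T s4 3 = X s by rewrite /X /rcell r4 r1.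
have Z4 : rcell T s4 4 = Z s by rewrite /Z /rcell r4 r1.
have X1 : rcell T s1 3 = X s by rewrite /X /rcell r1.
have K4 : nmem s4 21 0 = 0%N by rewrite n4 // n3.
have k4 : nmem s4 20 0 = 0%N by rewrite n4 // n3.
have m4 t : (t <= T)%N -> nmem s4 18 t = 0%N.
  by move=> tT; rewrite n4 // n3 //; have [] := A1 t tT.
have cs4 : cols_spec C T s4 (nmem s4 9) (nmem s4 10).
  by rewrite /cols_spec X4 !n4 // !n32 //; rewrite /cols_spec X1 in cs.
have P4 : ncell T s4 11 = ncell T s3 11 by rewrite /ncell n4.
have B4 : nmem s4 10 = nmem s3 10 by rewrite n4.
have := run_walk ss4 K4 k4 m4 cs4; rewrite X4 Z4 P4 B4 => /(_ pok st1).
move s5E : (run p_walk s4) => s5 wk.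
have ss5 : std C T s5 by rewrite -s5E; apply: std_run.
have r5 a : rmem s5 a = rmem s1 a by rewrite -s5E run_rmem.
have P5 : ncell T s5 11 = ncell T s3 11 by rewrite /ncell -s5E run_nmem // n4.
set P := ncell T s3 11 in pok wk P5.
set prot := (fun t => nmem s3 10 t != 0%N) in wk.
set ec := nmem s5 16 in wk; set es := nmem s5 17 in wk.
set k0 := nmem s5 20 0 in wk; set K := nmem s5 21 0 in wk.
have wr : (K <= T.+1)%N /\ forall k, (k < K)%N ->
    [/\ (ec k < C)%N, (es k <= T)%N & (P (ec k) (es k) <= T)%N].
  case: eqP wk => _; first by rewrite /K => ->.
  case=> _ wK _; split; first exact: walk_size wK.
  have [w1 _ _] := wK; move=> k /w1[eC eT eF].
  by have [] := pok _ _ eC eT eF.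
have W5 : forall c t, (c < C)%N -> (t <= T)%N -> rcell T s5 5 c t = 0.
  by move=> c t cC tT; rewrite /rcell r5; apply: W1.
have fl := run_flow ss5 wr.1; rewrite P5 in fl.
have {}fl := fl wr.2 W5.
move s6E : (run p_flow s5) fl => s6 fl.
have ss6 : std C T s6 by rewrite -s6E; apply: std_run.
have r6 a : a \notin rwrites p_flow -> rmem s6 a = rmem s1 a.
  by move=> h; rewrite -s6E run_rmem.
have pf := run_prefix ss6.
move s7E : (run p_prefix s6) pf => s7 pf.
have ss7 : std C T s7 by rewrite -s7E; apply: std_run.
have r7 a : a \notin rwrites p_flow ++ rwrites p_prefix -> rmem s7 a = rmem s1 a.
  by rewrite mem_cat => /norP[h1 h2]; rewrite -s7E run_rmem // r6.
have W7 : rcell T s7 5 = rcell T s6 5 by rewrite /rcell -s7E run_rmem.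
have mu7 : rmem s7 7 0 = 0 by rewrite r7.
have X7 : rcell T s7 3 = X s by rewrite /X /rcell r7 // r1.
have Z7 : rcell T s7 4 = Z s by rewrite /Z /rcell r7 // r1.
have ra := run_ratio ss7 mu7; rewrite X7 Z7 W7 in ra.
move s8E : (run p_ratio s7) ra => s8 ra.
have ss8 : std C T s8 by rewrite -s8E; apply: std_run.
have r8 a : a \notin rwrites p_ratio -> rmem s8 a = rmem s7 a.
  by move=> h; rewrite -s8E run_rmem.
have X8 : rcell T s8 3 = X s by rewrite -X7 /rcell r8.
have Z8 : rcell T s8 4 = Z s by rewrite -Z7 /rcell r8.
have W8 : rcell T s8 5 = rcell T s6 5 by rewrite -W7 /rcell r8.
have DZ8 : rcell T s8 6 = rcell T s7 6 by rewrite /rcell r8.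
have mv := run_move ss8; rewrite X8 Z8 W8 DZ8 in mv.
move s9E : (run p_move s8) mv => s9 mv.
have ss9 : std C T s9 by rewrite -s9E; apply: std_run.
have r9 : rmem s9 0 = E by rewrite -s9E run_rmem // r8 // r7 // r1.
rewrite r5 r1 // sE in fl.
set mu := rmem s8 7 0 in ra mv.
set w := flow E P ec es k0 K in fl.
set dz := fun c t => \sum_(u < t) w c u.
have wE c t : (c < C)%N -> (t <= T)%N ->
    w c t = rcell T s6 5 c t /\ dz c t = rcell T s7 6 c t.
  move=> cC tT; split; first by rewrite fl.
  by rewrite pf //; apply: eq_bigr => u _; rewrite fl //; have := ltn_ord u; lia.
have {}ra := max_ratio_ext wE ra.
have {}mv c t : (c < C)%N -> (t <= T)%N ->
    X s9 c t = X s c t + w c t / mu /\ Z s9 c t = Z s c t + dz c t / mu.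
  by move=> cC tT; have [-> ->] := wE _ _ cC tT; apply: mv.
have unprot t : (t < T)%N -> ~~ prot t ->
  forall c c', (c < C)%N -> (c' < C)%N ->
    frac (X s c t) -> frac (X s c' t) -> c = c'.
  move=> tT; rewrite negbK => /eqP Bt c c' cC cC' f f'.
  have [_ _ _ h] := cs4 t (ltnW tT); rewrite X4 B4 in h.
  by apply: succn_inj; rewrite (h Bt tT c cC f) (h Bt tT c' cC' f').
case: eqP wk => [nf K0|f0 cw].
  have w0 c t : w c t = 0 by rewrite /w /flow /K K0 big_geq.
  have e c t : (c < C)%N -> (t <= T)%N -> X s9 c t = X s c t /\ Z s9 c t = Z s c t.
    move=> cC tT; have [-> ->] := mv _ _ cC tT.
    rewrite w0 (_ : dz c t = 0) ?mul0r ?addr0 //.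
    by rewrite /dz big1.
  split; first by split=> //; apply: inv_ext iv.
  by left=> c t cC tT; have [-> _] := e _ _ cC tT; apply: st0.
have [dir nz] := flow_direction E0 pok cw.
split; first split=> //.
  by apply: (inv_ext mv); apply: (inv_move dir).
right; split; last by rewrite (nfrac_ext mv); apply: (nfrac_move dir).
have [cC tT f _] := st1 (introN eqP f0).
by move=> h; move: f; rewrite h.
Qed.

(** [k] is the number of iterations done and [N] a bound on the initial potential. *)
Definition progress N k s :=
  good s /\ (integral s \/ (nfrac C T (X s) (Z s) + k <= N)%N).

(** Integrality persists, because [run_iter] allows the alternative of a drop in potential only from
    a state that is not integral. *)
Lemma run_iters N k s :
  progress N k s -> progress N k.+2 (run (p_iter ;; p_iter) s).
Proof.
have step j s0 : progress N j s0 -> progress N j.+1 (run p_iter s0).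
  move=> [g0 h0]; have [g1 h1] := run_iter g0; split=> //.
  case: h1 => [|[ni lt]]; first by left.
  by right; case: h0 => [//|le]; lia.
by move=> h; rewrite run_seq; apply: (step); apply: step.
Qed.

End Iteration.

(* With [p_iter ;; p_iter] in place of [p], type checking unfolds the whole
   program and does not terminate in reasonable time. *)
Lemma run_double_loop (I : nat -> state R -> Prop) (p : prog) s :
  nmem s 0 0 = C -> nmem s 0 1 = T ->
  [&& 4%N \notin nwrites p, 5%N \notin nwrites p & 0%N \notin nwrites p] ->
  (forall k n s, I k s -> I k (setn 4 n s)) ->
  (forall k n s, I k s -> I k (setn 5 n s)) ->
  (forall k s, I k s -> I k.+2 (run p s)) ->
  I 0%N s -> I (2 * (C * T.+1))%N (run (PFor 4 0 0 (PFor 5 1 1 p)) s).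
Proof.
move=> sC sT /and3P[p4 p5 p0] I4 I5 step h.
have := @run_for R (fun c => I (2 * (c * T.+1))%N) 4%N 0%N 0%N (PFor 5 1 1 p) s.
rewrite addn0 sC; apply=> //; first by rewrite mul0n muln0; apply: (I4).
move=> c s1 _ _ sn _ h1; apply: (I4).
have s1T : nmem s1 0 1 = T by rewrite sn //= !inE negb_or p0.
suff : I (2 * (c * T.+1 + T.+1))%N (run (PFor 5 1 1 p) s1).
  by rewrite [(c.+1 * _)%N]mulSn addnC.
have := @run_for R (fun t => I (2 * (c * T.+1 + t))%N) 5%N 1%N 1%N p s1.
rewrite addn1 s1T; apply=> //; first by rewrite addn0; apply: (I5).
move=> t s2 _ _ _ _ h2; apply: (I5).
have -> : (2 * (c * T.+1 + t.+1) = (2 * (c * T.+1 + t)).+2)%N by lia.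
exact: step.
Qed.

(** After as many iterations as the initial potential can amount to, either integrality has been
    reached or the potential is 0, which means the same for x. *)
Lemma run_loop E y dd z0 s : (forall c, (c < C)%N -> E c != 0) ->
  (forall c t, dd c t = 0 \/ dd c t = 1) -> (forall c, z0 c 0%N = 0) ->
  good E y dd z0 s ->
  let s' := run (PFor 4 0 0 (PFor 5 1 1 (p_iter ;; p_iter))) s in
  good E y dd z0 s' /\ integral s'.
Proof.
move=> E0 dd01 z00 gs; have [[sC sT _] _ _] := gs.
set N := (2 * (C * T.+1))%N.
have : progress E y dd z0 N N (run (PFor 4 0 0 (PFor 5 1 1 (p_iter ;; p_iter))) s).
  apply: (run_double_loop sC sT) => //.
    by move=> k s1; apply: run_iters.
  by split=> //; right; rewrite addn0; apply: nfrac_le.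
move: (run _ s) => s' [g [//|le]]; split=> // c t cC tT.
apply: (@nfrac0 R C T (X s') (Z s')) => //.
by clearbody N; lia.
Qed.

End Main.

(** * Fractional parts of the prefix sums and their rounding *)

Section Prefix.
Variables (R : realType) (C T : nat).
Implicit Types s : state R.

Variable y : nat -> nat -> R.
Hypothesis y01 : forall c t, (c < C)%N -> (t < T)%N -> 0 <= y c t <= 1.

Let z0 c t := fpart (y c) t.
(** [dd] records whether the fractional part wraps around at column [t]. The value 1 in the virtual
    column matches its entry [1 - z0 c T]. *)
Let dd c t : R := if (t < T)%N then (1 <= z0 c t + y c t)%R%:R else 1.

Lemma fpart_bound c t : (c < C)%N -> (t <= T)%N -> 0 <= z0 c t < 1.
Proof.
move=> cC; rewrite /z0; elim: t => [|t IH] tT /=; first by rewrite lexx ltr01.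
have := IH (ltnW tT); have := y01 cC tT.
by case: ifP => [|/negbT]; rewrite -?ltNge; lra.
Qed.

Lemma fpart_step c t : (t < T)%N -> y c t = dd c t + z0 c t.+1 - z0 c t.
Proof. by move=> tT; rewrite /dd tT /z0 /=; case: ifP => _ /=; ring. Qed.

Lemma good_init (E : nat -> R) s : std C T s -> rmem s 0 = E ->
  (forall c t, (c < C)%N -> (t < T)%N -> rmem s 1 (c * T + t)%N = y c t) ->
  good C T E y dd z0 (run p_init s).
Proof.
move=> ss sE sy; have si := run_init ss.
have fy c t : (c < C)%N -> (t <= T)%N ->
    fpart (fun t => rmem s 1 (c * T + t)%N) t = z0 c t.
  move=> cC; rewrite /z0; elim: t => //= t IH tT.
  by rewrite IH ?(ltnW tT) // sy.
have iZ c t : (c < C)%N -> (t <= T)%N -> rcell T (run p_init s) 4 c t = z0 c t.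
  by move=> cC tT; have [h _ _] := si c cC; rewrite h // fy.
have iX c t : (c < C)%N -> (t < T)%N -> rcell T (run p_init s) 3 c t = y c t.
  by move=> cC tT; have [_ h _] := si c cC; rewrite h // sy.
have iT c : (c < C)%N -> rcell T (run p_init s) 3 c T = 1 - z0 c T.
  by move=> cC; have [_ _ h] := si c cC; rewrite h fy.
split; [by apply: std_run|by rewrite run_rmem|split].
- move=> c t cC tT; rewrite iZ //; have b := fpart_bound cC tT.
  split; last lra.
  move: tT; rewrite leq_eqVlt => /orP[/eqP e|tT]; last by rewrite iX ?y01.
  by rewrite e in b *; rewrite iT //; lra.
- move=> c t cC; rewrite leq_eqVlt => /orP[/eqP->|tT].
    by rewrite ltnn iT // iZ // /dd ltnn addr0.
  by rewrite tT iX // !iZ // ?(ltnW tT) // fpart_step.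
- by move=> c t cC tT; rewrite iZ.
by move=> t tT; left; apply: eq_bigr => c _; rewrite iX.
Qed.

(** The links telescope: with the same integer [n], the prefix sums of y and x are [n + z0] and
    [n + Z], where [Z] lies in [[0, 1]]. If [z0] vanishes then so does [Z]; otherwise the ceiling is
    at least [n + 1]. *)
Lemma prefix_round E s : good C T E y dd z0 s -> forall c t, (c < C)%N -> (t < T)%N ->
  (Num.floor (\sum_(i < t.+1) y c i))%:~R <= \sum_(i < t.+1) rcell T s 3 c i
    <= (Num.ceil (\sum_(i < t.+1) y c i))%:~R.
Proof.
move=> [_ _ [bnd lnk hz _]] c t cC tT.
have [n dn] : exists n : nat, \sum_(i < t.+1) dd c i = n%:R.
  elim: t tT => [|t IH] tT.
    rewrite big_ord1 /dd tT; by eexists.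
  have [n dn] := IH (ltnW tT); rewrite big_ord_recr /= dn /dd tT -natrD.
  by eexists.
have sumy : \sum_(i < t.+1) y c i = n%:R + z0 c t.+1.
  rewrite -dn; elim: (t.+1) tT => [|u IH] uT; first by rewrite !big_ord0 addr0.
  by rewrite !big_ord_recr /= IH ?(ltnW uT) // (fpart_step _ uT); ring.
have sumx : \sum_(i < t.+1) rcell T s 3 c i = n%:R + rcell T s 4 c t.+1.
  rewrite -dn; elim: (t.+1) tT => [|u IH] uT.
    by rewrite !big_ord0 (hz c 0%N) // addr0.
  rewrite !big_ord_recr /= IH ?(ltnW uT) // (lnk c u) ?(ltnW uT) // uT; ring.
have zb := fpart_bound cC tT; have [_ Zb] := bnd c t.+1 cC tT.
set P := \sum_(i < t.+1) y c i in sumy *.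
have fl : Num.floor P = n%:Z.
  by apply: floor_def; rewrite sumy -pmulrn intrD -pmulrn; lra.
rewrite fl sumx -pmulrn; apply/andP; split; first by lra.
have [z|nz] := eqVneq (z0 c t.+1) 0.
  by rewrite (hz _ _ cC tT z) addr0 -[n%:R]addr0 -z -sumy ceil_ge.
have : (n%:Z < Num.ceil P)%R.
  rewrite -(ltr_int R) -pmulrn; apply: lt_le_trans (ceil_ge P).
  by rewrite sumy ltrDl lt_def nz; case/andP: zb.
rewrite -lezD1 -(ler_int R) intrD -pmulrn => h; apply: le_trans h.
by lra.
Qed.

End Prefix.

(** * From memory cells back to matrices *)

Lemma at_natE (R : realType) n (f : 'I_n -> R) (i : 'I_n) : at_nat f i = f i.
Proof. by rewrite /at_nat valK. Qed.

Theorem theorem1 (R : realType) :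
  (forall (C T : nat) (E : 'I_C -> R) (y : 'M[R]_(C, T)),
     (0 < C)%N -> (0 < T)%N ->
     (forall c : 'I_C, E c != 0) ->
     (forall (c : 'I_C) (t : 'I_T), 0 <= y c t <= 1) ->
     exists x : 'M[R]_(C, T), is_rounding E y x)
  /\
  (exists (p : cmd) (K : nat),
     forall (C T : nat) (E : 'I_C -> R) (y : 'M[R]_(C, T)),
       (0 < C)%N -> (0 < T)%N ->
       (forall c : 'I_C, E c != 0) ->
       (forall (c : 'I_C) (t : 'I_T), 0 <= y c t <= 1) ->
       exists x : 'M[R]_(C, T),
         is_rounding E y x /\
         computes_within p E y x (K * (T ^ 2 * C ^ 2))%N).
Proof.
suff H : forall (C T : nat) (E : 'I_C -> R) (y : 'M[R]_(C, T)),
     (0 < C)%N -> (0 < T)%N ->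
     (forall c : 'I_C, E c != 0) ->
     (forall (c : 'I_C) (t : 'I_T), 0 <= y c t <= 1) ->
     exists x : 'M[R]_(C, T), is_rounding E y x /\
       computes_within (compile p_main) E y x (coef p_main * (T ^ 2 * C ^ 2))%N.
  split; last by exists (compile p_main), (coef p_main).
  by move=> C T E y C0 T0 E0 y01; have [x [rx _]] := H C T E y C0 T0 E0 y01; exists x.
move=> C T E y C0 T0 E0 y01.
set s0 := init E y.
pose Ef := rmem s0 0; pose yf c t := rmem s0 1 (c * T + t)%N.
have EfE (c : 'I_C) : Ef c = E c by rewrite /Ef /= at_natE.
have yfE (c : 'I_C) (t : 'I_T) : yf c t = y c t.
  rewrite /yf /= modnMDl divnMDl // modn_small // divn_small // addn0.
  by rewrite !at_natE.
have Ef0 c : (c < C)%N -> Ef c != 0.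
  by move=> cC; rewrite (EfE (Ordinal cC)).
have yf01 c t : (c < C)%N -> (t < T)%N -> 0 <= yf c t <= 1.
  by move=> cC tT; rewrite (yfE (Ordinal cC) (Ordinal tT)).
have [w dC dT] := main_wf.
have [n [ex le]] := @exec_compile R p_main s0 w C0 T0.
rewrite dC dT /= in le.
have ss : std C T (run p_base s0) by apply: run_base.
have hE : rmem (run p_base s0) 0 = Ef by rewrite run_rmem.
have hy c t : (c < C)%N -> (t < T)%N -> rmem (run p_base s0) 1 (c * T + t)%N = yf c t.
  by rewrite run_rmem.
have g0 := good_init yf01 ss hE hy.
set z0 := (fun c t => fpart (yf c) t) in g0.
set dd := (fun c t => if (t < T)%N then _ else 1) in g0.
have dd01 c t : dd c t = 0 \/ dd c t = 1.
  by rewrite /dd; case: ifP => _; [case: (1 <= _); [right|left]|right].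
have [g1 i1] := run_loop Ef0 dd01 (fun _ => erefl) g0.
have pr := prefix_round yf01 g1.
move sE : (run _ _) g1 i1 pr => s [ss2 sE0 [bnd _ _ col]] i1 pr.
pose x : 'M[R]_(C, T) := \matrix_(c, t) rcell T s 3 c t.
have prefixE (f : nat -> R) (t : 'I_T) :
    \sum_(i < T | (i <= t)%N) f i = \sum_(i < t.+1) f i.
  by rewrite (big_ord_widen_cond T xpredT f (ltn_ord t)).
exists x; split; last first.
  exists n, (run p_main s0); split=> // [|c t]; first by rewrite [(T ^ 2 * _)%N]mulnC.
  rewrite /p_main 3!run_seq sE mxE; exact: (run_out ss2 (ltn_ord c) (ltn_ord t)).
split=> [c t|c t|t].
- have [b _] := bnd c t (ltn_ord c) (ltnW (ltn_ord t)).
  by rewrite mxE; apply: (frac_split b); apply: i1 (ltnW _).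
- have := pr c t (ltn_ord c) (ltn_ord t).
  rewrite -!prefixE (eq_bigr (fun i => y c i)) => [|i _]; last by rewrite yfE.
  by rewrite [X in _ <= X <= _](eq_bigr (fun i => x c i)) // => i _; rewrite mxE.
have Mmax (c : 'I_C) : `|E c| <= \big[Num.max/0]_(c < C) `|E c|.
  by rewrite (le_bigmax _ (fun c => `|E c|)).
have sx : \sum_(c < C) E c * x c t = \sum_(c < C) Ef c * rcell T s 3 c t.
  by apply: eq_bigr => c _; rewrite EfE mxE.
have sy : \sum_(c < C) E c * y c t = \sum_(c < C) Ef c * yf c t.
  by apply: eq_bigr => c _; rewrite EfE yfE.
rewrite sx sy; case: (col t (ltn_ord t)) => [->|[c [v [cC v01 _ ->]]]].
  by rewrite subrr normr0; apply: le_trans (Mmax (Ordinal C0)).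
rewrite (EfE (Ordinal cC)) normrM; apply: le_trans (Mmax (Ordinal cC)).
(* The rounded entry is 0 or 1 and [v] lies in [[0, 1]], so they differ by at most 1. *)
rewrite ler_piMr // ler_norml.
have [b _] := bnd c t cC (ltnW (ltn_ord t)).
by case: (frac_split b (i1 c t cC (ltnW (ltn_ord t)))) => ->; lra.
Qed.
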